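(* For every $n\ge1$, the 0-Hecke-Clifford algebra $\mathcal{HC}_n$ is a Frobenius superalgebra with even trace map $$tr_n:\mathcal{HC}_n\to\mathbb K,\qquad tr_n(c_DT_w)=\delta_{D,\emptyset}\,\delta_{w,w_0}\quad(D\subseteq[n],\ w\in\mathfrak S_n),$$ where $w_0$ is the longest element of $\mathfrak S_n$. Moreover, the corresponding Nakayama automorphism is the even algebra involution $\varphi$ of $\mathcal{HC}_n$ given by $\varphi(T_i)=T_{n-i}+c_{n-i}c_{n+1-i}$ ($1\le i\le n-1$) and $\varphi(c_j)=-c_{n+1-j}$ ($1\le j\le n$).
   Context: $\mathbb K$ is an algebraically closed field of characteristic $0$. The 0-Hecke-Clifford superalgebra $\mathcal{HC}_n$ is generated by even $T_1,\dots,T_{n-1}$ and odd $c_1,\dots,c_n$ with relations $T_i^2=-T_i$, $T_iT_j=T_jT_i$ ($|i-j|>1$), $T_iT_{i+1}T_i=T_{i+1}T_iT_{i+1}$, $c_i^2=-1$, $c_ic_j=-c_jc_i$ ($i\ne j$), $T_ic_j=c_jT_i$ ($j\neq i,i+1$), $T_ic_i=c_{i+1}T_i$, $(T_i+1)c_{i+1}=c_i(T_i+1)$. It has basis $\{c_DT_w:D\subseteq[n],w\in\mathfrak S_n\}$, where $c_D=c_{i_1}\cdots c_{i_r}$ for $D=\{i_1<\cdots<i_r\}$ and $T_w=T_{j_1}\cdots T_{j_s}$ for any reduced expression $w=s_{j_1}\cdots s_{j_s}$. A finite-dimensional superalgebra $A$ is a Frobenius superalgebra with trace map $tr$ if $tr:A\to\mathbb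 K$ is an even linear map (vanishing on odd elements) whose kernel contains no non-zero left ideal of $A$. Put $(a,b)=tr(ab)$. The Nakayama automorphism is the even automorphism $\varphi$ of $A$ with $(a,b)=(-1)^{|a||b|}(\varphi(b),a)$ for all homogeneous $a,b\in A$. *)

(* Defs.v *)
From HB Require Import structures.
From mathcomp Require Import all_boot all_order all_algebra all_fingroup.
From mathcomp Require Import generic_quotient ring_quotient boolp finmap.
From mathcomp Require Import monalg zify.

Set Implicit Arguments.
Unset Strict Implicit.
Unset Printing Implicit Defensive.

Import GRing.Theory.
Local Open Scope ring_scope.

(* Frobenius superalgebras.  A superalgebra is an algebra A together with the *)
(* predicate gr, where gr b x means that x lies in the homogeneous component  *)
(* of parity b (false for even, true for odd).                                *)

Section Superalgebras.
Variables (K : fieldType) (A : algType K).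
Implicit Types (gr : bool -> A -> Prop) (tr : {scalar A}).

Definition is_superalgebra gr : Prop :=
  [/\ forall b, gr b 0 /\ (forall (a : K) x y, gr b x -> gr b y -> gr b (a *: x + y)),
      forall x, exists x0 x1, [/\ gr false x0, gr true x1 & x = x0 + x1],
      forall x, gr false x -> gr true x -> x = 0,
      gr false 1
    & forall b b' x y, gr b x -> gr b' y -> gr (b (+) b') (x * y)].

Definition finite_dimensional : Prop :=
  exists m (e : 'I_m -> A),
    forall x, exists k : 'I_m -> K, x = \sum_(i < m) k i *: e i.

(* Closure under addition and left multiplication makes I a K-subspace. *)
Definition left_ideal (I : A -> Prop) : Prop :=
  [/\ I 0, forall x y, I x -> I y -> I (x + y) & forall a x, I x -> I (a * x)].

Definition is_frobenius_superalgebra gr tr : Prop :=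
  [/\ is_superalgebra gr,
      finite_dimensional,
      forall x, gr true x -> tr x = 0
    & forall I : A -> Prop, left_ideal I -> (forall x, I x -> tr x = 0) ->
        forall x, I x -> x = 0].

Definition is_nakayama_automorphism gr tr (phi : {lrmorphism A -> A}) : Prop :=
  [/\ bijective phi,
      forall b x, gr b x -> gr b (phi x)
    & forall b b' x y, gr b x -> gr b' y ->
        tr (x * y) = (-1) ^+ (b * b') * tr (phi y * x)].

End Superalgebras.

(* Indices are shifted by one: the index set {1, ..., n-1} of the T_i and s_i *)
(* is 'I_n.-1, the index set [n] of the c_j is 'I_n, and i : 'I_n.-1 stands   *)
(* for the adjacent pair (adjl i, adjr i) = (i, i+1) in 'I_n.                 *)

Definition adjl n (i : 'I_n.-1) : 'I_n := widen_ord (leq_pred n) i.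

Lemma adjr_subproof n (i : 'I_n.-1) : (i.+1 < n)%N.
Proof. by rewrite -ltn_predRL. Qed.

Definition adjr n (i : 'I_n.-1) : 'I_n := Ordinal (adjr_subproof i).

Section SymmetricGroup.
Variable n : nat.
Implicit Types (i : 'I_n.-1) (s : seq 'I_n.-1) (w : 'S_n).

Definition simple_refl i : 'S_n := tperm (adjl i) (adjr i).

(* The product is the group law of 'S_n, which composes from left to right;   *)
(* the opposite order exchanges w and w^-1, which have the same length.       *)
Definition word_perm s : 'S_n := (\prod_(i <- s) simple_refl i)%g.

Lemma word_perm_cat s t : word_perm (s ++ t) = (word_perm s * word_perm t)%g.
Proof. exact: big_cat. Qed.

Lemma tperm_word (x y : 'I_n) : exists s, word_perm s == tperm x y.
Proof.
wlog le_xy : x y / (x <= y)%N.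
  by move=> H; case: (leqP x y) => [|/ltnW] /H // ; rewrite tpermC.
have [d] := ubnP (y - x); elim: d y le_xy => // d IH y le_xy ltd.
have [->|neq_xy] := eqVneq x y.
  by exists [::]; rewrite /word_perm big_nil tperm1.
have lt_xy : (x < y)%N by rewrite ltn_neqAle neq_xy le_xy.
have y0 : (0 < y)%N by apply: leq_ltn_trans lt_xy.
have ltz : (y.-1 < n.-1)%N.
  by rewrite ltn_predRL prednK.
pose i := Ordinal ltz.
have Ey : y = adjr i by apply: val_inj; rewrite /= prednK.
have [eq_x|neq_x] := eqVneq x (adjl i).
  by exists [:: i]; rewrite /word_perm big_seq1 /simple_refl eq_x Ey.
have [||s /eqP Es] := IH (adjl i).
- by rewrite /= -ltnS prednK.
- rewrite /= -(ltn_add2r 1) !addn1; apply: leq_trans ltd.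
  by rewrite ltnS ltn_sub2rE //= ?prednK // -ltnS prednK.
exists (i :: s ++ [:: i]); rewrite -cat1s !word_perm_cat Es /word_perm !big_seq1.
apply/eqP; rewrite -[X in (X * _)%g]tpermV -conjgE tpermJ.
rewrite tpermL tpermD ?Ey // 1?eq_sym //.
by apply: contraNneq neq_xy => ->; rewrite Ey.
Qed.

Lemma has_word w : exists k, [exists t : k.-tuple 'I_n.-1, word_perm t == w].
Proof.
suff [s Es] : exists s, word_perm s == w.
  by exists (size s); apply/existsP; exists (in_tuple s).
have [ts -> _] := prod_tpermP w.
elim: ts => [|xy ts [t /eqP Et]]; first by exists [::]; rewrite /word_perm !big_nil.
have [u /eqP Eu] := tperm_word xy.1 xy.2.
by exists (u ++ t); rewrite word_perm_cat Eu Et big_cons.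
Qed.

Definition perm_length w : nat := ex_minn (has_word w).

Definition reduced_expression s w : Prop :=
  word_perm s = w /\ size s = perm_length w.

Definition longest_perm : 'S_n := [arg max_(w > 1%g) perm_length w].

End SymmetricGroup.

(* The 0-Hecke-Clifford algebra, as the quotient of the free algebra on the   *)
(* letters T_i (inl i) and c_j (inr j) by the two-sided ideal generated by    *)
(* the defining relations.                                                    *)

Notation HC_letter n := ('I_n.-1 + 'I_n)%type.
Notation HC_free K n := {malg K[{fmonom (HC_letter n)}]}.

Section Presentation.
Variables (K : fieldType) (n : nat).
Local Notation F := (HC_free K n).

Definition free_T (i : 'I_n.-1) : F := << fmu (inl i) >>.
Definition free_c (j : 'I_n) : F := << fmu (inr j) >>.

Inductive HC_rel : F -> F -> Prop :=
| HC_rel_TT i :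
    HC_rel (free_T i * free_T i) (- free_T i)
| HC_rel_TTcomm (i j : 'I_n.-1) : (i.+1 < j)%N || (j.+1 < i)%N ->
    HC_rel (free_T i * free_T j) (free_T j * free_T i)
| HC_rel_braid (i j : 'I_n.-1) : j = i.+1 :> nat ->
    HC_rel (free_T i * free_T j * free_T i) (free_T j * free_T i * free_T j)
| HC_rel_cc j :
    HC_rel (free_c j * free_c j) (- 1)
| HC_rel_ccanti i j : i != j ->
    HC_rel (free_c i * free_c j) (- (free_c j * free_c i))
| HC_rel_Tccomm i j : j != adjl i -> j != adjr i ->
    HC_rel (free_T i * free_c j) (free_c j * free_T i)
| HC_rel_Tcl i :
    HC_rel (free_T i * free_c (adjl i)) (free_c (adjr i) * free_T i)
| HC_rel_Tcr i :
    HC_rel ((free_T i + 1) * free_c (adjr i)) (free_c (adjl i) * (free_T i + 1)).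

Inductive HC_ideal : F -> Prop :=
| HC_ideal_rel l r : HC_rel l r -> HC_ideal (l - r)
| HC_ideal0 : HC_ideal 0
| HC_idealD x y : HC_ideal x -> HC_ideal y -> HC_ideal (x + y)
| HC_idealM a x b : HC_ideal x -> HC_ideal (a * x * b).

Definition HC_pred : {pred F} := fun x => `[< HC_ideal x >].

Lemma HC_predP x : reflect (HC_ideal x) (x \in HC_pred).
Proof. exact: asboolP. Qed.

Lemma HC_pred_zmod_closed : zmod_closed HC_pred.
Proof.
split=> [|x y /HC_predP hx /HC_predP hy]; apply/HC_predP; first exact: HC_ideal0.
apply: HC_idealD => //.
by rewrite -[- y]mulN1r -[_ * y]mulr1; apply: HC_idealM.
Qed.

HB.instance Definition _ := GRing.isZmodClosed.Build F HC_pred HC_pred_zmod_closed.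

End Presentation.

(* An algType is not the zero ring, so 1 must be shown not to be in the       *)
(* ideal.  The algebra acts on functions f on {0,1}^n by signed               *)
(* substitutions, (x f)(e) = (-1)^(sg x e) f(mv x e) for each letter x: this  *)
(* is the module induced from the one-dimensional module on which all T_i     *)
(* act by 0, the vertex e standing for the Clifford monomial c_e.             *)

Module Nontrivial.
Section Action.
Variables (K : fieldType) (n : nat).
Local Notation F := (HC_free K n).
Local Notation E := {ffun 'I_n -> bool}.
Implicit Types (i : 'I_n.-1) (j : 'I_n) (e : E) (f : E -> K).

Definition flip (j : 'I_n) e : E := [ffun k => e k (+) (k == j)].

Definition par (j : 'I_n) e : bool := \big[addb/false]_(k < n | (k < j)%N) e k.

Definition sg (x : HC_letter n) e : bool :=
  match x with inl i => e (adjr i) | inr j => par j e (+) ~~ e j end.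

Definition mv (x : HC_letter n) e : E :=
  match x with
  | inl i => if e (adjr i) then e else flip (adjl i) (flip (adjr i) e)
  | inr j => flip j e
  end.

Definition act1 x f e : K := (-1) ^+ sg x e * f (mv x e).

Definition actw (w : seq (HC_letter n)) f : E -> K := foldr act1 f w.

Definition act (p : F) f e : K :=
  mmap (idfun : K -> K) (fun w : {fmonom (HC_letter n)} => actw w f e) p.

Lemma actw_lin w (I : Type) (r : seq I) (k : I -> K) (f : I -> E -> K) g e :
  (forall e, g e = \sum_(i <- r) k i * f i e) ->
  actw w g e = \sum_(i <- r) k i * actw w (f i) e.
Proof.
move=> Eg; elim: w e => [//|x w IH] e /=.
rewrite /act1 IH mulr_sumr; apply: eq_bigr => i _.
by rewrite mulrCA.
Qed.

Lemma actD p q f e : act (p + q) f e = act p f e + act q f e.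
Proof. exact: mmapD. Qed.
Lemma actN p f e : act (- p) f e = - act p f e.
Proof. exact: mmapN. Qed.
Lemma act0 f e : act 0 f e = 0.
Proof. exact: mmap0. Qed.
Lemma actU c (w : {fmonom (HC_letter n)}) f e : act << c *g w >> f e = c * actw w f e.
Proof. exact: mmapU. Qed.
Lemma act_1 f e : act 1 f e = f e.
Proof. by rewrite actU mul1r /= fm1. Qed.

Lemma actM p q f e : act (p * q) f e = act p (act q f) e.
Proof.
rewrite malgME /act raddf_sum /= mmapE; apply: eq_bigr => w _.
rewrite (@actw_lin w _ (msupp q) (fun u => q@_u) (fun u => actw u f)) //.
rewrite raddf_sum mulr_sumr /=; apply: eq_bigr => u _.
by rewrite mmapU mulrA fmM /actw foldr_cat.
Qed.

Lemma act2 x y f e : act (<< fmu x >> * << fmu y >>) f e = act1 x (act1 y f) e.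
Proof.
rewrite actM actU mul1r fmU /= /act1; congr (_ * _).
by rewrite actU mul1r fmU.
Qed.

Lemma act3 x y z f e :
  act (<< fmu x >> * << fmu y >> * << fmu z >>) f e = act1 x (act1 y (act1 z f)) e.
Proof.
rewrite -mulrA actM actU mul1r fmU /= /act1; congr (_ * _).
by rewrite act2.
Qed.

Lemma act1E x f e : act << fmu x >> f e = act1 x f e.
Proof. by rewrite actU mul1r fmU. Qed.

Lemma flipE j e k : flip j e k = e k (+) (k == j).
Proof. exact: ffunE. Qed.

Lemma flipK j e : flip j (flip j e) = e.
Proof. by apply/ffunP=> k; rewrite !flipE -addbA addbb addbF. Qed.

Lemma flipC (j k : 'I_n) e : flip j (flip k e) = flip k (flip j e).
Proof. by apply/ffunP=> l; rewrite !flipE addbAC. Qed.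

Lemma par_flip j k e : par j (flip k e) = par j e (+) (k < j)%N.
Proof.
rewrite /par (eq_bigr (fun l => e l (+) (l == k))) => [|l _]; last exact: flipE.
rewrite big_split /=; congr (_ (+) _).
have [ltkj|lejk] := ltnP k j.
  by rewrite (bigD1 k) //= eqxx big1 // => l /andP[_ /negPf].
rewrite big1 // => l ltlj; apply/eqP=> Elk.
by rewrite Elk ltnNge lejk in ltlj.
Qed.

Lemma par_adjr (i : 'I_n.-1) e : par (adjr i) e = par (adjl i) e (+) e (adjl i).
Proof.
rewrite /par (bigD1 (adjl i)) //= addbC; congr (_ (+) _).
by apply: eq_bigl => k; rewrite ltnS ltn_neqAle andbC.
Qed.

Lemma adj_neq (i : 'I_n.-1) : (adjl i == adjr i) = false.
Proof. by rewrite -val_eqE /= ltn_eqF. Qed.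

Lemma act1_TT i f e : act1 (inl i) (act1 (inl i) f) e = - act1 (inl i) f e.
Proof.
rewrite /act1 /=; case Ei: (e (adjr i)); rewrite ?Ei /=; first by rewrite mulN1r.
by rewrite !flipE Ei eqxx eq_sym adj_neq /= !mul1r mulN1r.
Qed.

Lemma act1_TTcomm (i j : 'I_n.-1) f e : (i.+1 < j)%N || (j.+1 < i)%N ->
  act1 (inl i) (act1 (inl j) f) e = act1 (inl j) (act1 (inl i) f) e.
Proof.
move=> far.
have nrr : (adjr i == adjr j) = false by rewrite -val_eqE /=; move: far; lia.
have nlr : (adjr i == adjl j) = false by rewrite -val_eqE /=; move: far; lia.
have nrl : (adjr j == adjl i) = false by rewrite -val_eqE /=; move: far; lia.
have nrr' : (adjr j == adjr i) = false by rewrite eq_sym.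
rewrite /act1 /=; case Ei: (e (adjr i)); case Ej: (e (adjr j));
  rewrite ?flipE ?Ei ?Ej ?nrr ?nlr ?nrl ?nrr' /= ?mul1r ?mulr1 //.
congr f; apply/ffunP=> k; rewrite !flipE.
by case: (e k); case: (k == _); case: (k == _); case: (k == _); case: (k == _).
Qed.

Lemma act1_braid (i j : 'I_n.-1) f e : j = i.+1 :> nat ->
  act1 (inl i) (act1 (inl j) (act1 (inl i) f)) e =
  act1 (inl j) (act1 (inl i) (act1 (inl j) f)) e.
Proof.
move=> Eij.
have Elr : adjl j = adjr i by apply: val_inj; rewrite /= Eij.
have n1 : (adjr j == adjr i) = false by rewrite -val_eqE /=; lia.
have n2 : (adjr j == adjl i) = false by rewrite -val_eqE /=; lia.
have n3 : (adjr i == adjl i) = false by rewrite eq_sym adj_neq.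
have n4 : (adjr i == adjr j) = false by rewrite eq_sym n1.
rewrite /act1 /= Elr.
case Ei: (e (adjr i)); case Ej: (e (adjr j));
  do 6?rewrite ?flipE ?Ei ?Ej ?eqxx ?n1 ?n2 ?n3 ?n4 /=;
  rewrite ?mul1r ?mulr1 ?mulN1r //.
by rewrite opprK flipK [flip (adjr j) (flip _ _)]flipC flipK flipC.
Qed.

Lemma act1_cc j f e : act1 (inr j) (act1 (inr j) f) e = - f e.
Proof.
rewrite /act1 /= flipK mulrA -signr_addb par_flip ltnn flipE eqxx.
by case: (par j e); case: (e j); rewrite /= mulN1r.
Qed.

Lemma act1_ccanti (i j : 'I_n) f e : i != j ->
  act1 (inr i) (act1 (inr j) f) e = - act1 (inr j) (act1 (inr i) f) e.
Proof.
move=> neq; rewrite /act1 /= flipC !mulrA -!signr_addb -mulNr -signrN; congr (_ ^+ _ * _).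
rewrite !par_flip !flipE (negPf neq) [j == i]eq_sym (negPf neq).
move: neq; rewrite -val_eqE neq_ltn /= => /orP[lt|lt]; rewrite lt ltnNge (ltnW lt) /=;
by case: (par i e); case: (par j e); case: (e i); case: (e j).
Qed.

Lemma act1_Tccomm i j f e : j != adjl i -> j != adjr i ->
  act1 (inl i) (act1 (inr j) f) e = act1 (inr j) (act1 (inl i) f) e.
Proof.
move=> nl nr; rewrite /act1 /= flipE eq_sym (negPf nr) addbF.
case Ei: (e (adjr i)); first by rewrite mulrCA.
rewrite mul1r; congr (_ ^+ _ * _).
  rewrite !par_flip !flipE (negPf nl) (negPf nr) !addbF -addbA.
  suff -> : (adjr i < j)%N = (adjl i < j)%N by rewrite -!addbA; case: (par j e); case: (_ < j)%N; case: (e j).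
  by move: nl nr; rewrite -!val_eqE /=; lia.
by rewrite [in RHS]mul1r; congr f; apply/ffunP=> k; rewrite !flipE; case: (e k); case: (k == _); case: (k == _); case: (k == _).
Qed.

Lemma act1_Tcl i f e :
  act1 (inl i) (act1 (inr (adjl i)) f) e = act1 (inr (adjr i)) (act1 (inl i) f) e.
Proof.
have n3 : (adjr i == adjl i) = false by rewrite eq_sym adj_neq.
rewrite /act1 /= flipE eqxx addbT par_adjr; case Ei: (e (adjr i)) => /=.
  rewrite !flipK; by case: (par _ e); case: (e _); rewrite /= ?mul1r ?mulN1r ?opprK.
rewrite !par_flip !flipE !flipK adj_neq eqxx /= ltnn [(_ < _)%N]ltnNge leqnSn /=.
by case: (par _ e); case: (e _); rewrite /= ?mul1r ?mulN1r ?opprK.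
Qed.

Lemma act1_Tcr i f e :
  act1 (inl i) (act1 (inr (adjr i)) f) e + act1 (inr (adjr i)) f e =
  act1 (inr (adjl i)) (act1 (inl i) f) e + act1 (inr (adjl i)) f e.
Proof.
have n3 : (adjr i == adjl i) = false by rewrite eq_sym adj_neq.
rewrite /act1 /= !flipE ?eqxx ?n3 ?adj_neq !addbF !par_adjr; case Ei: (e (adjr i)) => /=.
  rewrite Ei; by case: (par _ e); case: (e _); rewrite /= ?mul1r ?mulN1r ?opprK ?addNr ?subrr.
rewrite !par_flip !flipE Ei adj_neq n3 !eqxx /= ltnn [(_ < _)%N]ltnNge leqnSn /=.
rewrite [flip (adjr i) (flip _ _)]flipC flipK [flip (adjr i) (flip _ _)]flipC flipK.
by case: (par _ e); case: (e _); rewrite /= ?mul1r ?mulN1r ?opprK // addrC.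
Qed.

Lemma actD1M (p q : F) f e : act ((p + 1) * q) f e = act (p * q) f e + act q f e.
Proof. by rewrite mulrDl mul1r actD. Qed.

Lemma actMD1 (p q : F) f e : act (q * (p + 1)) f e = act (q * p) f e + act q f e.
Proof. by rewrite mulrDr mulr1 actD. Qed.

Lemma act_Tcr i f e :
  act ((free_T K i + 1) * free_c K (adjr i)) f e =
  act (free_c K (adjl i) * (free_T K i + 1)) f e.
Proof.
apply: etrans (actD1M _ _ _ _) (etrans _ (esym (actMD1 _ _ _ _))).
apply: etrans (congr2 +%R (act2 _ _ _ _) (act1E _ _ _)) _.
apply: etrans (act1_Tcr _ _ _) _.
exact: esym (congr2 +%R (act2 _ _ _ _) (act1E _ _ _)).
Qed.

Lemma act_rel (l r : F) f e : HC_rel l r -> act l f e = act r f e.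
Proof.
case=> {l r}.
- move=> i; apply: etrans (act2 _ _ _ _) _; rewrite act1_TT actN.
  by congr (- _); rewrite act1E.
- move=> i j far; apply: etrans (act2 _ _ _ _) _.
  exact: etrans (act1_TTcomm _ _ far) (esym (act2 _ _ _ _)).
- move=> i j Eij; apply: etrans (act3 _ _ _ _ _) _.
  exact: etrans (act1_braid _ _ Eij) (esym (act3 _ _ _ _ _)).
- move=> j; apply: etrans (act2 _ _ _ _) _; rewrite act1_cc actN.
  by congr (- _); rewrite act_1.
- move=> i j neq; apply: etrans (act2 _ _ _ _) _; rewrite act1_ccanti // actN.
  by congr (- _); rewrite act2.
- move=> i j nl nr; apply: etrans (act2 _ _ _ _) _.
  exact: etrans (act1_Tccomm _ _ nl nr) (esym (act2 _ _ _ _)).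
- move=> i; apply: etrans (act2 _ _ _ _) _.
  exact: etrans (act1_Tcl _ _ _) (esym (act2 _ _ _ _)).
- move=> i; exact: act_Tcr.
Qed.

Lemma actp0 (p : F) f e : (forall e, f e = 0) -> act p f e = 0.
Proof.
move=> f0; rewrite /act mmapE big1 // => w _.
suff -> : actw w f e = 0 by rewrite mulr0.
by elim: (w : seq _) e => [|x v IH] e //=; rewrite /act1 IH mulr0.
Qed.

Lemma act_ideal (p : F) : HC_ideal p -> forall f e, act p f e = 0.
Proof.
elim=> {p} [l r lr f e | f e | x y _ IHx _ IHy f e | a x b _ IHx f e].
- by rewrite actD actN (act_rel _ _ lr) subrr.
- exact: act0.
- by rewrite actD IHx IHy addr0.
- by rewrite -mulrA actM; apply: actp0 => e'; rewrite actM.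
Qed.

Lemma HC_ideal_proper : ~ HC_ideal (1 : F).
Proof.
move=> /act_ideal/(_ (fun=> 1) [ffun=> false])/eqP.
by rewrite act_1 oner_eq0.
Qed.

End Action.
End Nontrivial.

Lemma malg_scalerAr (K : fieldType) (M : monomType) a (x y : {malg K[M]}) :
  a *: (x * y) = x * (a *: y).
Proof.
rewrite -(mul_malgC a (x * y)) -(mul_malgC a y) [LHS]mulrA [RHS]mulrA.
congr (_ * y); rewrite (mul_malgC a x) malgM_def fgmulgU {1}[x]monalgE scaler_sumr.
apply: eq_bigr => w _; apply/malgP => v.
by rewrite mcoeffZ !mcoeffU mulm1 mulrnAr mulrC.
Qed.

Section Algebra.
Variables (K : fieldType) (n : nat).
Local Notation F := (HC_free K n).
Local Open Scope quotient_scope.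

Definition HC := Quotient.quot (@HC_pred K n).

HB.instance Definition _ := ZmodQuotient.on HC.
HB.instance Definition _ := Choice.on HC.

Lemma HC_eqP (x y : F) : reflect (HC_ideal (x - y)) (x == y %[mod HC]).
Proof. by rewrite -Quotient.idealrBE; apply: HC_predP. Qed.

Definition HC_one : HC := \pi_HC 1.
Definition HC_mul (x y : HC) : HC := \pi_HC (repr x * repr y).
Definition HC_scale (a : K) (x : HC) : HC := \pi_HC (a *: repr x).

Lemma HC_repr (x : F) : HC_ideal (repr (\pi_HC x) - x).
Proof. by apply/HC_eqP; rewrite reprK. Qed.

Lemma HC_pi_mul (x y : F) : HC_mul (\pi_HC x) (\pi_HC y) = \pi_HC (x * y).
Proof.
apply/eqP/HC_eqP; set x' := repr _; set y' := repr _.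
rewrite (_ : _ - _ = 1 * (x' - x) * y' + x * (y' - y) * 1); last first.
  by rewrite mul1r mulr1 mulrBl mulrBr addrA subrK.
by apply: HC_idealD; apply: HC_idealM; apply: HC_repr.
Qed.

Lemma HC_pi_scale a (x : F) : HC_scale a (\pi_HC x) = \pi_HC (a *: x).
Proof.
apply/eqP/HC_eqP; rewrite -scalerBr -mul_malgC -[_ * _]mulr1.
exact/HC_idealM/HC_repr.
Qed.

Lemma HC_piD (x y : F) : \pi_HC (x + y) = \pi_HC x + \pi_HC y.
Proof. exact: raddfD. Qed.

Lemma HC_mulA : associative HC_mul.
Proof.
elim/quotW=> x; elim/quotW=> y; elim/quotW=> z.
rewrite (HC_pi_mul y z) (HC_pi_mul x y) (HC_pi_mul x (y * z)).
by rewrite (HC_pi_mul (x * y) z) mulrA.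
Qed.

Lemma HC_mul1 : left_id HC_one HC_mul.
Proof. by elim/quotW=> x; rewrite (HC_pi_mul 1 x) mul1r. Qed.

Lemma HC_mul1r : right_id HC_one HC_mul.
Proof. by elim/quotW=> x; rewrite (HC_pi_mul x 1) mulr1. Qed.

Lemma HC_mulDl : left_distributive HC_mul +%R.
Proof.
elim/quotW=> x; elim/quotW=> y; elim/quotW=> z.
rewrite -(HC_piD x y) (HC_pi_mul (x + y) z) (HC_pi_mul x z) (HC_pi_mul y z).
by rewrite -HC_piD mulrDl.
Qed.

Lemma HC_mulDr : right_distributive HC_mul +%R.
Proof.
elim/quotW=> x; elim/quotW=> y; elim/quotW=> z.
rewrite -(HC_piD y z) (HC_pi_mul x (y + z)) (HC_pi_mul x y) (HC_pi_mul x z).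
by rewrite -HC_piD mulrDr.
Qed.

Lemma HC_one_neq0 : HC_one != 0.
Proof.
rewrite -[0]reprK; apply/HC_eqP => h.
apply: (@Nontrivial.HC_ideal_proper K n).
have h0 : HC_ideal (repr (0 : HC)).
  by rewrite -[repr _]subr0; apply/HC_eqP; rewrite reprK raddf0.
by rewrite -(subrK (repr (0 : HC)) 1); apply: HC_idealD.
Qed.

HB.instance Definition _ := GRing.Zmodule_isNzRing.Build HC
  HC_mulA HC_mul1 HC_mul1r HC_mulDl HC_mulDr HC_one_neq0.

Lemma HC_scaleA a b x : HC_scale a (HC_scale b x) = HC_scale (a * b) x.
Proof.
elim/quotW: x => x.
by rewrite (HC_pi_scale b x) (HC_pi_scale a (b *: x)) (HC_pi_scale (a * b) x) scalerA.
Qed.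

Lemma HC_scale1 : left_id 1 HC_scale.
Proof. by elim/quotW=> x; rewrite (HC_pi_scale 1 x) scale1r. Qed.

Lemma HC_scaleDr : right_distributive HC_scale +%R.
Proof.
move=> a; elim/quotW=> x; elim/quotW=> y.
rewrite -(HC_piD x y) (HC_pi_scale a (x + y)) (HC_pi_scale a x) (HC_pi_scale a y).
by rewrite -HC_piD scalerDr.
Qed.

Lemma HC_scaleDl x : {morph HC_scale^~ x : a b / a + b}.
Proof.
elim/quotW: x => x a b.
rewrite (HC_pi_scale (a + b) x) (HC_pi_scale a x) (HC_pi_scale b x).
by rewrite -HC_piD scalerDl.
Qed.

HB.instance Definition _ := GRing.Zmodule_isLmodule.Build K HC
  HC_scaleA HC_scale1 HC_scaleDr HC_scaleDl.

Lemma HC_scalerAl a (x y : HC) : a *: (x * y) = a *: x * y.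
Proof.
elim/quotW: x => x; elim/quotW: y => y.
apply: etrans (congr1 (HC_scale a) (HC_pi_mul x y)) _.
apply: etrans (HC_pi_scale a (x * y)) _; rewrite scalerAl -(HC_pi_mul (a *: x) y).
by rewrite -(HC_pi_scale a x).
Qed.

HB.instance Definition _ := GRing.Lmodule_isLalgebra.Build K HC HC_scalerAl.

Lemma HC_scalerAr a (x y : HC) : a *: (x * y) = x * (a *: y).
Proof.
elim/quotW: x => x; elim/quotW: y => y.
apply: etrans (congr1 (HC_scale a) (HC_pi_mul x y)) _.
apply: etrans (HC_pi_scale a (x * y)) _; rewrite malg_scalerAr -(HC_pi_mul x (a *: y)).
by rewrite -(HC_pi_scale a y).
Qed.

HB.instance Definition _ := GRing.Lalgebra_isAlgebra.Build K HC HC_scalerAr.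

Definition HC_T (i : 'I_n.-1) : HC := \pi_HC (free_T K i).
Definition HC_c (j : 'I_n) : HC := \pi_HC (free_c K j).

(* The ordinals are enumerated increasingly, so c_D lists D in that order. *)
Definition HC_cset (D : {set 'I_n}) : HC := \prod_(j in D) HC_c j.
Definition HC_Tword (s : seq 'I_n.-1) : HC := \prod_(i <- s) HC_T i.

Definition word_parity (w : seq (HC_letter n)) : bool :=
  odd (count (fun x => if x is inr _ then true else false) w).

(* x is homogeneous of parity b when it is represented by a combination of    *)
(* words with b letters c_j modulo 2.                                         *)
Definition HC_parity (b : bool) (x : HC) : Prop :=
  exists2 p : F, (forall w : {fmonom (HC_letter n)}, w \in msupp p -> word_parity w = b)
               & x = \pi_HC p.

(* T_w is the product over any reduced expression s of w. *)
Definition HC_trace_values (tr : {scalar HC}) : Prop :=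
  forall (D : {set 'I_n}) (w : 'S_n) (s : seq 'I_n.-1), reduced_expression s w ->
    tr (HC_cset D * HC_Tword s) = (D == set0)%:R * (w == longest_perm n)%:R.

End Algebra.

Arguments HC_T K {n}.
Arguments HC_c K {n}.

(* Main.v *)
(* The algebra acts on functions on {0,1}^n x S_n: this is the module induced  *)
(* from the H_n(0)-module of functions on S_n, on which [T_i] is minus the     *)
(* operator that sorts positions i, i+1 into decreasing order.  Evaluating     *)
(* [x . delta] at the identity, where [delta] is the indicator of              *)
(* (empty set, w0), gives the trace up to sign, so no linear independence of   *)
(* the basis is needed beforehand.  For [T_i] the Nakayama identity holds      *)
(* because sorting positions commutes with sorting values; for [c_j] it is     *)
(* checked on the spanning set [c_D T_w], where for length reasons only the    *)
(* leading term survives.  Non-degeneracy follows by pairing with              *)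
(* [c_D T_(w^-1 w0)] for [w] of maximal length in the support.                 *)

Require Import Defs.
From HB Require Import structures.
From mathcomp Require Import all_boot all_order all_algebra all_fingroup.
From mathcomp Require Import generic_quotient ring_quotient boolp finmap.
From mathcomp Require Import monalg zify ring.

Set Implicit Arguments.
Unset Strict Implicit.
Unset Printing Implicit Defensive.

Import GRing.Theory.
Local Open Scope ring_scope.

(** * Inversions and the 0-Hecke monoid *)

(** Everything is computed in one explicit module of functions on pairs (e, x), with e a subset of
    [n] and x a permutation ([rep_action]). A generator [T_i] acts by a sorting part, which moves x
    by [sort_step], plus a Clifford part, which leaves x alone. [HC_tr] is a single matrix
    coefficient of this action. One letter raises the number of inversions by at most one
    ([sort_word_inv]), so a word in the [T_i] carries the identity to [w0] only if it has at least
    [ninv w0] letters, and a word of exactly that length does so only by swapping at every letter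
    ([sort_word_full]). This length count yields the values of the trace, its uniqueness follows
    because the elements c_D T_w span ([HC_spanned]), and it also isolates leading terms below.

    The Nakayama identity is proved one generator at a time and extended to words ([HC_tr_word]).
    For [T_i] ([HC_tr_mulT]), [T_i] changes the top vector in the same way as sorting two adjacent
    values; this operator commutes with the whole action, so it can be carried to the evaluation
    point, where the correction c_i c_(i+1) removes the unwanted Clifford term. For [c_j]
    ([HC_tr_mulc]), both sides are compared on c_D T_w, where only D = {n+1-j} survives.

    Non-degeneracy: by [HC_tr_mulT], the radical of the form is stable under right multiplication by
    the [T_i]. Multiplying a radical element by T_(w^-1 w0), with w of maximal length in its
    support, then exposes a single coefficient ([HC_tr_pairing]), which must vanish.

    The map phi exists because T_i + c_i c_(i+1) is a Clifford conjugate of -(T_i + 1), and the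
    latter elements satisfy the 0-Hecke relations ([twist_braid]). It is the only Nakayama
    automorphism because the form is also non-degenerate on the other side
    ([HC_right_nondegenerate]). The characteristic enters through the invertibility of 2, which
    identifies parity with the eigenvalue of the automorphism c_j -> -c_j ([HC_parityP]). *)

Section Inversions.
Variable n : nat.
Local Open Scope group_scope.
Implicit Types (i j : 'I_n.-1) (s t : seq 'I_n.-1) (w x y : 'S_n).
Local Notation sr := (@simple_refl n).

Lemma adjl_neq_adjr i : adjl i != adjr i.
Proof. by rewrite -val_eqE /=; lia. Qed.

Lemma simple_reflE i (k : 'I_n) :
  sr i k = if k == adjl i then adjr i else if k == adjr i then adjl i else k.
Proof. by rewrite /simple_refl permE. Qed.

Lemma simple_refl_adjl i : sr i (adjl i) = adjr i.
Proof. exact: tpermL. Qed.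

Lemma simple_refl_adjr i : sr i (adjr i) = adjl i.
Proof. exact: tpermR. Qed.

Lemma simple_reflK i : involutive (sr i).
Proof. exact: tpermK. Qed.

Lemma simple_refl_mulK i x : sr i * (sr i * x) = x.
Proof. by rewrite mulgA tperm2 mul1g. Qed.

Lemma simple_refl_lt i (a b : 'I_n) : a != b ->
  (sr i a < sr i b)%N = (a < b)%N (+)
    ((a == adjl i) && (b == adjr i) || (a == adjr i) && (b == adjl i)).
Proof.
case: a b => [a la] [b lb]; rewrite !simple_reflE -!val_eqE /=.
by do 5?case: eqP => /=; lia.
Qed.

Lemma word_perm_nil : word_perm [::] = 1 :> 'S_n.
Proof. exact: big_nil. Qed.

Lemma word_perm_cons i s : word_perm (i :: s) = sr i * word_perm s.
Proof. exact: big_cons. Qed.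

Lemma word_perm_rev s : word_perm (rev s) = (word_perm s)^-1.
Proof.
elim: s => [|i s IH]; first by rewrite !word_perm_nil invg1.
rewrite rev_cons -cats1 word_perm_cat IH !word_perm_cons word_perm_nil mulg1.
by rewrite invMg /simple_refl tpermV.
Qed.

(** * Inversions, Coxeter length and the longest element *)

Definition inv_set x := [set p : 'I_n * 'I_n | (p.1 < p.2)%N && (x p.2 < x p.1)%N].
Definition ninv x := #|inv_set x|.

Lemma inv1 : ninv 1 = 0%N.
Proof. by apply: eq_card0 => -[a b]; rewrite !inE !perm1 /=; lia. Qed.

(** Products compose from left to right, so [sr i * x] exchanges the entries in positions i and i+1.
    Applying [sr i] to both members of a pair of positions matches the inversions of [x] with those
    of [sr i * x] other than (i, i+1). *)
Lemma inv_simple_refl i x : (x (adjl i) < x (adjr i))%N -> ninv (sr i * x) = (ninv x).+1.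
Proof.
move=> lt_x; rewrite /ninv (cardsD1 (adjl i, adjr i)) inE /= !permM.
rewrite simple_refl_adjl simple_refl_adjr lt_x ltnSn /= add1n; congr _.+1.
pose f (p : 'I_n * 'I_n) := (sr i p.1, sr i p.2).
have fK : involutive f by move=> [a b]; rewrite /f /= !simple_reflK.
rewrite -(card_imset (inv_set x) (inv_inj fK)); apply: eq_card => p.
rewrite -[in RHS](fK p) (mem_imset _ _ (inv_inj fK)) !inE /= !permM.
case: p => a b /=; have [->|neq_ab] := eqVneq a b; first by rewrite !ltnn !andbF.
rewrite simple_refl_lt // xpair_eqE.
have [Ea|na] /= := eqVneq a (adjl i).
  have [Eb|nb] /= := eqVneq b (adjr i); first by rewrite Ea Eb /= ltnSn.
  by rewrite Ea (negPf (adjl_neq_adjr i)) addbF.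
have [Ea|na'] /= := eqVneq a (adjr i); last by rewrite addbF.
have [Eb|nb] /= := eqVneq b (adjl i); last by rewrite addbF.
rewrite Ea Eb simple_refl_adjl simple_refl_adjr /=; move: lt_x; lia.
Qed.

Lemma perm_adj_neq i x : x (adjl i) != x (adjr i).
Proof. by rewrite (inj_eq perm_inj) adjl_neq_adjr. Qed.

Lemma perm_adj_ltNge i x : (x (adjr i) < x (adjl i))%N = ~~ (x (adjl i) < x (adjr i))%N.
Proof. by have := perm_adj_neq i x; rewrite -val_eqE /=; lia. Qed.

Lemma simple_refl_mul_asc i x : ~~ (x (adjl i) < x (adjr i))%N ->
  ((sr i * x)%g (adjl i) < (sr i * x)%g (adjr i))%N.
Proof. by rewrite !permM simple_refl_adjl simple_refl_adjr perm_adj_ltNge. Qed.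

Lemma inv_simple_refl_desc i x : ~~ (x (adjl i) < x (adjr i))%N ->
  ninv x = (ninv (sr i * x)).+1.
Proof.
by move/simple_refl_mul_asc/inv_simple_refl; rewrite simple_refl_mulK.
Qed.

Lemma inv_word_perm s : (ninv (word_perm s) <= size s)%N.
Proof.
elim: s => [|i s IH]; first by rewrite word_perm_nil inv1.
rewrite word_perm_cons /=; case: (boolP (word_perm s (adjl i) < word_perm s (adjr i))%N).
  by move/inv_simple_refl->.
by move/inv_simple_refl_desc; lia.
Qed.

(** Values grow at least as fast as positions; comparing with the first and the last position leaves
    no slack. *)
Lemma ascending_perm1 x : (forall i, (x (adjl i) < x (adjr i))%N) -> x = 1.
Proof.
move=> asc.
have step (a b : 'I_n) : (a <= b)%N -> (x a + (b - a) <= x b)%N.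
  have [d Ed] : exists d, d = (b - a)%N by exists (b - a)%N.
  elim: d b Ed => [|d IH] b Ed le_ab.
    have -> : a = b by apply: val_inj => /=; lia.
    by lia.
  have ltb : (b.-1 < n.-1)%N by have := ltn_ord b; lia.
  have Eb : b = adjr (Ordinal ltb) by apply: val_inj => /=; lia.
  have := IH (adjl (Ordinal ltb)); have := asc (Ordinal ltb).
  by rewrite -Eb /=; lia.
apply/permP=> k; rewrite perm1; apply: val_inj => /=.
have n0 : (0 < n)%N by case: k => /= m; lia.
have n1 : (n.-1 < n)%N by lia.
have := step (Ordinal n0) k (leq0n _); have := step k (Ordinal n1).
have := ltn_ord (x (Ordinal n1)); have := ltn_ord k => /=; lia.
Qed.

Lemma inv_word w : exists s, word_perm s = w /\ size s = ninv w.
Proof.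
have [d] := ubnP (ninv w); elim: d w => // d IH w ltd.
have [/forallP asc|] := boolP [forall i : 'I_n.-1, w (adjl i) < w (adjr i)]%N.
  exists [::]; rewrite (ascending_perm1 asc) inv1; split=> //.
  by rewrite word_perm_nil.
case/forallPn=> i desc; have E := inv_simple_refl_desc desc.
have [|s [Es sz]] := IH (sr i * w); first by lia.
by exists (i :: s); rewrite word_perm_cons Es simple_refl_mulK E /= sz.
Qed.

(** A word needs at least one letter per inversion ([inv_word_perm]), and removing descents one by
    one produces a word with exactly that many letters ([inv_word]). *)
Lemma perm_lengthE w : perm_length w = ninv w.
Proof.
rewrite /perm_length; case: ex_minnP => m /existsP[t /eqP Et] min_m.
apply/eqP; rewrite eqn_leq; apply/andP; split.
  have [s [Es <-]] := inv_word w; apply: min_m; apply/existsP.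
  by exists (in_tuple s); rewrite /= Es.
by rewrite -Et; apply: leq_trans (inv_word_perm _) _; rewrite size_tuple.
Qed.

Lemma reducedE s w : reduced_expression s w <-> word_perm s = w /\ size s = ninv w.
Proof. by rewrite /reduced_expression perm_lengthE. Qed.

Lemma invV w : ninv w^-1 = ninv w.
Proof.
suff le x : (ninv x^-1 <= ninv x)%N.
  by apply/eqP; rewrite eqn_leq le -{1}[w]invgK le.
have [s [<- <-]] := inv_word x.
by rewrite -word_perm_rev -(size_rev s) inv_word_perm.
Qed.

(** The order-reversing permutation, a concrete form of [longest_perm] (see [longest_permE]). *)
Definition w0 : 'S_n := perm (can_inj (@rev_ordK n)).

Lemma w0E k : w0 k = rev_ord k. Proof. exact: permE. Qed.

Lemma w0V : w0^-1 = w0.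
Proof.
apply: (mulIg w0); rewrite mulVg; apply/permP=> k.
by rewrite permM !w0E rev_ordK perm1.
Qed.

(** Right multiplication by [w0] reverses values, so every pair of positions is an inversion of
    exactly one of [w] and [w * w0], while [w0] inverts all pairs. *)
Lemma inv_w0_sub w : (ninv w + ninv (w * w0))%N = ninv w0.
Proof.
rewrite /ninv -cardsUI [X in (_ + X)%N](_ : _ = 0%N) ?addn0.
  apply: eq_card => -[a b]; rewrite !inE /= !permM !w0E /=.
  have := ltn_ord (w a); have := ltn_ord (w b); have := ltn_ord b; have := ltn_ord a.
  have [->|] := eqVneq a b; first by lia.
  rewrite -(inj_eq (@perm_inj _ w)) -val_eqE /=; lia.
apply: eq_card0 => -[a b]; rewrite !inE /= !permM !w0E /=.
have := ltn_ord (w a); have := ltn_ord (w b); lia.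
Qed.

Lemma inv_w0_max w : (ninv w0 <= ninv w)%N -> w = w0.
Proof.
move=> ge; have := inv_w0_sub w => E.
have : ninv (w * w0) = 0%N by lia.
move/eqP; rewrite cards_eq0 => /eqP none.
suff E1 : w * w0 = 1 by rewrite -[LHS](mulgK w0) E1 mul1g w0V.
apply: ascending_perm1 => i; apply: contraT; rewrite -perm_adj_ltNge => gt.
suff : (adjl i, adjr i) \in inv_set (w * w0) by rewrite none inE.
by rewrite inE /= ltnSn.
Qed.

Lemma longest_permE : longest_perm n = w0.
Proof.
rewrite /longest_perm; case: arg_maxnP => // w _ max_w.
by apply: inv_w0_max; rewrite -!perm_lengthE; apply: max_w.
Qed.

Lemma reduced_consP i s w : reduced_expression (i :: s) w ->
  reduced_expression s (sr i * w) /\ ~~ (w (adjl i) < w (adjr i))%N.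
Proof.
rewrite !reducedE word_perm_cons /= => -[<- sz].
rewrite simple_refl_mulK; have le := inv_word_perm s.
have desc : ~~ ((sr i * word_perm s)%g (adjl i) < (sr i * word_perm s)%g (adjr i))%N.
  by apply/negP => /inv_simple_refl; rewrite simple_refl_mulK; lia.
split=> //; split=> //.
by have := inv_simple_refl_desc desc; rewrite simple_refl_mulK; lia.
Qed.

Lemma reduced_cons i s w : ~~ (w (adjl i) < w (adjr i))%N ->
  reduced_expression s (sr i * w) -> reduced_expression (i :: s) w.
Proof.
rewrite !reducedE word_perm_cons /= => /inv_simple_refl_desc -> [-> ->].
by rewrite simple_refl_mulK.
Qed.

(* The 0-Hecke monoid acting on permutations by sorting into decreasing order. *)
Definition sort_step i x := if (x (adjl i) < x (adjr i))%N then sr i * x else x.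

Definition sort_word s x := foldl (fun y i => sort_step i y) x s.

Lemma sort_step_inv i x : (ninv (sort_step i x) <= (ninv x).+1)%N.
Proof. by rewrite /sort_step; case: ifP => [/inv_simple_refl->|]. Qed.

Lemma sort_word_inv s x : (ninv (sort_word s x) <= ninv x + size s)%N.
Proof.
elim: s x => [|i s IH] x /=; first by rewrite addn0.
by apply: leq_trans (IH _) _; have := sort_step_inv i x; lia.
Qed.

(** Equality in [sort_word_inv] forces every letter to perform a genuine swap. The word gets
    reversed because the first letter acts first and so becomes the innermost left factor. *)
Lemma sort_word_full s x : ninv (sort_word s x) = (ninv x + size s)%N ->
  sort_word s x = word_perm (rev s) * x.
Proof.
elim: s x => [|i s IH] x /=; first by rewrite word_perm_nil mul1g.
have le := sort_word_inv s (sort_step i x); have le1 := sort_step_inv i x => E.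
rewrite IH; last by lia.
rewrite rev_cons -cats1 word_perm_cat word_perm_cons word_perm_nil mulg1 -mulgA.
congr (_ * _); rewrite /sort_step; case: ifP => // /negbT desc.
by move: le; rewrite {2}/sort_step (negPf desc); lia.
Qed.

(** Sorting never idles along a reduced word: the last letter is an ascent of the inverse of the
    preceding product, which is what the sorting has reached so far. *)
Lemma sort_word_reduced s w : reduced_expression s w -> sort_word s 1 = w^-1.
Proof.
rewrite reducedE => -[Es sz].
suff E : ninv (sort_word s 1) = (ninv 1 + size s)%N.
  by rewrite sort_word_full // mulg1 word_perm_rev Es.
have : ninv (word_perm s) = size s by rewrite Es.
elim/last_ind: s {Es sz} => [|s i IH]; first by rewrite /= inv1.
rewrite -cats1 word_perm_cat word_perm_cons word_perm_nil mulg1 size_cat /= addn1.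
rewrite -invV invMg /simple_refl tpermV -/(simple_refl i) => E.
have le : (ninv (word_perm s)^-1 <= size s)%N by rewrite invV inv_word_perm.
have asc : ((word_perm s)^-1 (adjl i) < (word_perm s)^-1 (adjr i))%N.
  by apply: contraT => /inv_simple_refl_desc; rewrite E; lia.
move: E; rewrite inv_simple_refl // invV => -[Es].
have IHs := IH Es; have full := sort_word_full IHs.
rewrite mulg1 word_perm_rev in full.
by rewrite /sort_word foldl_cat /= -/(sort_word s 1) full /sort_step asc
  inv_simple_refl // invV Es inv1.
Qed.

Lemma sort_stepK i x : sort_step i (sort_step i x) = sort_step i x.
Proof.
rewrite /sort_step; case: (boolP (x (adjl i) < x (adjr i))%N) => [lt|/negPf->] //.
by rewrite !permM simple_refl_adjl simple_refl_adjr ltnNge (ltnW lt).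
Qed.

Lemma simple_refl_far i j : (i.+1 < j)%N || (j.+1 < i)%N ->
  (sr i (adjl j) = adjl j) * (sr i (adjr j) = adjr j).
Proof.
by move=> far; rewrite !simple_reflE !ifN // -val_eqE /=; lia.
Qed.

Lemma simple_refl_commute i j : (i.+1 < j)%N || (j.+1 < i)%N ->
  sr i * sr j = sr j * sr i.
Proof.
move=> far; apply/permP => k; rewrite !permM.
have far' : (j.+1 < i)%N || (i.+1 < j)%N by rewrite orbC.
have [->|n1] := eqVneq k (adjl i).
  by rewrite simple_refl_adjl !(simple_refl_far far') simple_refl_adjl.
have [->|n2] := eqVneq k (adjr i).
  by rewrite simple_refl_adjr !(simple_refl_far far') simple_refl_adjr.
have Ek : sr i k = k by rewrite simple_reflE (negPf n1) (negPf n2).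
rewrite Ek; have [->|m1] := eqVneq k (adjl j).
  by rewrite simple_refl_adjl !(simple_refl_far far).
have [->|m2] := eqVneq k (adjr j).
  by rewrite simple_refl_adjr !(simple_refl_far far).
by rewrite simple_reflE (negPf m1) (negPf m2) Ek.
Qed.

Lemma sort_step_far i j x : (i.+1 < j)%N || (j.+1 < i)%N ->
  sort_step i (sort_step j x) = sort_step j (sort_step i x).
Proof.
move=> far; have far' : (j.+1 < i)%N || (i.+1 < j)%N by rewrite orbC.
rewrite /sort_step; case: (boolP (x (adjl j) < x (adjr j))%N) => lj;
  case: (boolP (x (adjl i) < x (adjr i))%N) => li;
  rewrite ?permM ?(simple_refl_far far) ?(simple_refl_far far')
    ?lj ?li ?(negPf lj) ?(negPf li) //.
by rewrite !mulgA simple_refl_commute.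
Qed.

Section Braid.
Variables i j : 'I_n.-1.
Hypothesis Eij : j = i.+1 :> nat.

Lemma adjl_next : adjl j = adjr i.
Proof. by apply: val_inj. Qed.

Lemma adj_next_neq : ((adjr j == adjl i) = false) * ((adjr j == adjr i) = false)
  * ((adjl i == adjr j) = false) * ((adjr i == adjr j) = false)
  * ((adjr i == adjl i) = false) * ((adjl i == adjr i) = false).
Proof. by rewrite -!val_eqE /= Eij; do !split; lia. Qed.

Lemma simple_refl_next :
  (sr i (adjr j) = adjr j) * (sr j (adjl i) = adjl i) * (sr j (adjr i) = adjr j)
  * (sr j (adjr j) = adjr i).
Proof. by rewrite !simple_reflE adjl_next !adj_next_neq !eqxx. Qed.

Lemma simple_refl_braid : sr i * sr j * sr i = sr j * sr i * sr j.
Proof.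
apply/permP=> k; rewrite !permM.
have [->|n1] := eqVneq k (adjl i).
  by do !rewrite ?simple_refl_next ?simple_refl_adjl ?simple_refl_adjr.
have [->|n2] := eqVneq k (adjr i).
  by do !rewrite ?simple_refl_next ?simple_refl_adjl ?simple_refl_adjr.
have [->|n3] := eqVneq k (adjr j).
  by do !rewrite ?simple_refl_next ?simple_refl_adjl ?simple_refl_adjr.
have Ei : sr i k = k by rewrite simple_reflE (negPf n1) (negPf n2).
have Ej : sr j k = k by rewrite simple_reflE adjl_next (negPf n2) (negPf n3).
by rewrite Ei Ej Ei Ej.
Qed.

(** Both sides put the three entries concerned into decreasing order; the proof runs over their
    possible relative orders. *)
Lemma sort_step_braid x :
  sort_step i (sort_step j (sort_step i x)) = sort_step j (sort_step i (sort_step j x)).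
Proof.
have EV y := (permM (sr i) y, permM (sr j) y).
have neq (k l : 'I_n) : (k == l) = false -> (x k == x l :> nat) = false.
  by move=> nkl; rewrite (inj_eq val_inj) (inj_eq perm_inj).
have := neq _ _ adj_next_neq.1.1.1.1.1; have := neq _ _ adj_next_neq.1.1.1.1.2.
have := neq _ _ adj_next_neq.2; rewrite /sort_step adjl_next.
case ab: (x (adjl i) < x (adjr i))%N; case bc: (x (adjr i) < x (adjr j))%N;
case ac: (x (adjl i) < x (adjr j))%N; try lia; move=> nab ncb nca;
have ba : (x (adjr i) < x (adjl i))%N = ~~ (x (adjl i) < x (adjr i))%N by lia.
all: have cb : (x (adjr j) < x (adjr i))%N = ~~ (x (adjr i) < x (adjr j))%N by lia.
all: have ca : (x (adjr j) < x (adjl i))%N = ~~ (x (adjl i) < x (adjr j))%N by lia.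
all: do 6?rewrite ?EV ?simple_refl_next ?simple_refl_adjl ?simple_refl_adjr
       ?ab ?bc ?ac ?ba ?cb ?ca ?ab ?bc ?ac /= //.
by rewrite !mulgA simple_refl_braid.
Qed.

End Braid.

(** Positions of the inverse are values of [x]: the values k and k+1 are exchanged unless the larger
    one already comes first. *)
Definition sort_value k x := (sort_step k x^-1)^-1.

Lemma sort_valueE k x :
  sort_value k x = if (x^-1 (adjl k) < x^-1 (adjr k))%N then x * sr k else x.
Proof.
rewrite /sort_value /sort_step; case: ifP => _; last by rewrite invgK.
by rewrite invMg invgK /simple_refl tpermV.
Qed.

(** If [x] maps the positions i, i+1 onto the values k, k+1 (the condition [sp]), both operations
    are the same swap under the same test. Otherwise neither affects the comparison made by the
    other. *)
Lemma sort_step_value i k x :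
  sort_step i (sort_value k x) = sort_value k (sort_step i x).
Proof.
have Ei : (sr i)^-1 = sr i by apply: tpermV.
pose sp := (x (adjl i) == adjl k) && (x (adjr i) == adjr k) ||
           (x (adjl i) == adjr k) && (x (adjr i) == adjl k).
have Esp : (x^-1 (adjl k) == adjl i) && (x^-1 (adjr k) == adjr i) ||
           (x^-1 (adjl k) == adjr i) && (x^-1 (adjr k) == adjl i) = sp.
  have E (a b : 'I_n) : (x^-1 a == b) = (x b == a).
    by rewrite -(inj_eq (@perm_inj _ x)) permKV eq_sym.
  by rewrite !E /sp [X in _ || X]andbC.
have P' : ((x * sr k)%g (adjl i) < (x * sr k)%g (adjr i))%N
        = (x (adjl i) < x (adjr i))%N (+) sp.
  by rewrite !permM simple_refl_lt // perm_adj_neq.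
have Q' : ((sr i * x)^-1%g (adjl k) < (sr i * x)^-1%g (adjr k))%N
        = (x^-1 (adjl k) < x^-1 (adjr k))%N (+) sp.
  by rewrite invMg Ei !permM simple_refl_lt ?Esp // perm_adj_neq.
have PQ : sp -> (x (adjl i) < x (adjr i))%N = (x^-1 (adjl k) < x^-1 (adjr k))%N.
  by case/orP=> /andP[/eqP E1 /eqP E2]; rewrite -E1 -E2 !permK E1 E2 /=; lia.
have E : sp -> sr i * x = x * sr k.
  move=> hsp; apply: (mulgI x^-1); rewrite mulKg /simple_refl -conjgE tpermJ.
  by case/orP: hsp => /andP[/eqP -> /eqP ->] //; rewrite tpermC.
rewrite !sort_valueE /sort_step.
case: (boolP (x (adjl i) < x (adjr i))%N) => P;
  case: (boolP (x^-1 (adjl k) < x^-1 (adjr k))%N) => Q;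
  rewrite ?P' ?Q' ?P ?Q ?(negPf P) ?(negPf Q) //=.
- by case: (boolP sp) => [/E|] // _; rewrite mulgA.
- by case: (boolP sp) => // /PQ; rewrite P (negPf Q).
- by case: (boolP sp) => // /PQ; rewrite Q (negPf P).
Qed.

End Inversions.

(** * Modules over the presented algebra *)

Section FreeAction.
Variables (K : fieldType) (n : nat) (V : lmodType K).
Variable g : HC_letter n -> {linear V -> V}.
Local Notation F := (HC_free K n).
Implicit Types (p q : F) (u v : V).

Definition word_act (w : seq (HC_letter n)) v : V := foldr (fun x => g x) v w.

Definition free_act p v : V := \sum_(w <- msupp p) p@_w *: word_act w v.

Lemma free_actEw (d : {fset {fmonom (HC_letter n)}}) p v : (msupp p `<=` d)%fset ->
  free_act p v = \sum_(w <- d) p@_w *: word_act w v.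
Proof.
move=> le; rewrite /free_act; apply: big_fset_incl le _ => w _ /mcoeff_outdom ->.
by rewrite scale0r.
Qed.

Lemma word_actD w u v : word_act w (u + v) = word_act w u + word_act w v.
Proof. by elim: w => //= x w ->; rewrite linearD. Qed.

Lemma word_actZ w a v : word_act w (a *: v) = a *: word_act w v.
Proof. by elim: w => //= x w ->; rewrite linearZ. Qed.

Lemma word_act0 w : word_act w 0 = 0.
Proof. by elim: w => //= x w ->; rewrite linear0. Qed.

Lemma free_actP a p q v : free_act (a *: p + q) v = a *: free_act p v + free_act q v.
Proof.
pose d := (msupp p `|` msupp q)%fset.
rewrite (@free_actEw d (a *: p + q)); last first.
  apply: fsubset_trans (msuppD_le _ _) _; apply: fsetSU; exact: msuppZ_le.
rewrite (@free_actEw d p) ?fsubsetUl // (@free_actEw d q) ?fsubsetUr //.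
rewrite scaler_sumr -big_split /=; apply: eq_bigr => w _.
by rewrite mcoeffD mcoeffZ scalerDl scalerA.
Qed.

Lemma free_act0 v : free_act 0 v = 0.
Proof. by rewrite /free_act msupp0 big_seq_fset0. Qed.

Lemma free_actD p q v : free_act (p + q) v = free_act p v + free_act q v.
Proof. by rewrite -[p]scale1r free_actP !scale1r. Qed.

Lemma free_actN p v : free_act (- p) v = - free_act p v.
Proof. by have := free_actP (-1) p 0 v; rewrite free_act0 !addr0 !scaleN1r. Qed.

Lemma free_act_sum (I : Type) (r : seq I) (f : I -> F) v :
  free_act (\sum_(i <- r) f i) v = \sum_(i <- r) free_act (f i) v.
Proof.
by elim: r => [|i r IH]; rewrite ?big_nil ?free_act0 // !big_cons free_actD IH.
Qed.

Lemma free_actU a (w : {fmonom (HC_letter n)}) v :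
  free_act << a *g w >> v = a *: word_act w v.
Proof. by rewrite (free_actEw v msuppU_le) big_seq_fset1 mcoeffUU. Qed.

Lemma free_actvP p a u v : free_act p (a *: u + v) = a *: free_act p u + free_act p v.
Proof.
rewrite /free_act scaler_sumr -big_split /=; apply: eq_bigr => w _.
by rewrite word_actD word_actZ scalerDr !scalerA mulrC.
Qed.

Lemma free_actv0 p : free_act p 0 = 0.
Proof. by rewrite /free_act big1 // => w _; rewrite word_act0 scaler0. Qed.

Lemma free_actM p q v : free_act (p * q) v = free_act p (free_act q v).
Proof.
rewrite malgME free_act_sum [RHS]/free_act; apply: eq_bigr => w _.
rewrite free_act_sum /free_act -[word_act w _]/(_).
have -> : word_act w (\sum_(w' <- msupp q) q@_w' *: word_act w' v) =
  \sum_(w' <- msupp q) q@_w' *: word_act w (word_act w' v).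
  elim: (enum_fset (msupp q)) => [|w' r IH]; last by rewrite !big_cons word_actD word_actZ IH.
  by rewrite !big_nil word_act0.
rewrite scaler_sumr; apply: eq_bigr => w' _.
by rewrite -/(free_act _ _) free_actU scalerA fmM /word_act foldr_cat.
Qed.

Lemma free_act1 v : free_act 1 v = v.
Proof. by rewrite free_actU scale1r fm1. Qed.

Lemma free_act_T i v : free_act (free_T K i) v = g (inl i) v.
Proof. by rewrite free_actU scale1r fmU. Qed.

Lemma free_act_c j v : free_act (free_c K j) v = g (inr j) v.
Proof. by rewrite free_actU scale1r fmU. Qed.

Definition HC_action := forall l r : F, HC_rel l r -> forall v, free_act l v = free_act r v.

Lemma HC_actionP :
  (forall i v, g (inl i) (g (inl i) v) = - g (inl i) v) ->
  (forall (i j : 'I_n.-1), (i.+1 < j)%N || (j.+1 < i)%N ->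
     forall v, g (inl i) (g (inl j) v) = g (inl j) (g (inl i) v)) ->
  (forall (i j : 'I_n.-1), j = i.+1 :> nat -> forall v,
     g (inl i) (g (inl j) (g (inl i) v)) = g (inl j) (g (inl i) (g (inl j) v))) ->
  (forall j v, g (inr j) (g (inr j) v) = - v) ->
  (forall i j, i != j -> forall v, g (inr i) (g (inr j) v) = - g (inr j) (g (inr i) v)) ->
  (forall i j, j != adjl i -> j != adjr i -> forall v,
     g (inl i) (g (inr j) v) = g (inr j) (g (inl i) v)) ->
  (forall i v, g (inl i) (g (inr (adjl i)) v) = g (inr (adjr i)) (g (inl i) v)) ->
  (forall i v, g (inl i) (g (inr (adjr i)) v) + g (inr (adjr i)) v =
     g (inr (adjl i)) (g (inl i) v) + g (inr (adjl i)) v) ->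
  HC_action.
Proof.
move=> TT Tf Tb cc ca Tc Tl Tr l r.
have EM x y v : free_act (<< fmu x >> * << fmu y >> : F) v = g x (g y v).
  by rewrite free_actM !free_actU !scale1r !fmU.
have EM3 x y z v : free_act (<< fmu x >> * << fmu y >> * << fmu z >> : F) v = g x (g y (g z v)).
  by rewrite free_actM EM free_actU scale1r fmU.
have EU x v : free_act (<< fmu x >> : F) v = g x v by rewrite free_actU scale1r fmU.
case=> {l r} [i|i j H|i j H|j|i j H|i j H H'|i|i] v.
- rewrite free_actN [LHS]EM EU; exact: TT.
- rewrite [LHS]EM [RHS]EM; exact: Tf.
- rewrite [LHS]EM3 [RHS]EM3; exact: Tb.
- rewrite free_actN [LHS]EM free_act1; exact: cc.
- rewrite free_actN [LHS]EM EM; exact: ca.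
- rewrite [LHS]EM [RHS]EM; exact: Tc.
- rewrite [LHS]EM [RHS]EM; exact: Tl.
apply: etrans (free_actM _ _ _) (etrans _ (esym (free_actM _ _ _))).
have ET u : free_act (free_T K i + 1) u = g (inl i) u + u.
  by apply: etrans (free_actD _ _ _) (congr2 +%R (EU _ _) (free_act1 _)).
apply: etrans (ET _) (etrans _ (esym (EU _ _))).
apply: etrans (congr2 +%R (congr1 (g _) (EU _ _)) (EU _ _)) (etrans (Tr i v) _).
by rewrite -linearD; congr (g _ _); apply/esym/ET.
Qed.

Hypothesis g_action : HC_action.

Lemma free_act_ideal p : HC_ideal p -> forall v, free_act p v = 0.
Proof.
elim=> {p} [l r lr v|v|p q _ IHp _ IHq v|p x q _ IH v].
- by rewrite free_actD free_actN (g_action lr) subrr.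
- exact: free_act0.
- by rewrite free_actD IHp IHq addr0.
by rewrite !free_actM IH free_actv0.
Qed.

Definition HC_act (x : HC K n) v : V := free_act (repr x) v.

Lemma HC_act_pi p v : HC_act (\pi_(HC K n) p)%qT v = free_act p v.
Proof.
apply/eqP; rewrite -subr_eq0 -free_actN -free_actD.
by rewrite free_act_ideal //; apply: HC_repr.
Qed.

Lemma HC_actM x y v : HC_act (x * y) v = HC_act x (HC_act y v).
Proof.
elim/quotW: x => p; elim/quotW: y => q.
apply: etrans (congr1 (HC_act^~ v) (HC_pi_mul p q)) _.
apply: etrans (HC_act_pi _ _) (etrans (free_actM _ _ _) _).
exact: esym (etrans (HC_act_pi _ _) (congr1 (free_act p) (HC_act_pi _ _))).
Qed.

Lemma HC_actP a x y v : HC_act (a *: x + y) v = a *: HC_act x v + HC_act y v.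
Proof.
elim/quotW: x => p; elim/quotW: y => q.
apply: etrans (congr1 (fun z => HC_act (z + _) v) (HC_pi_scale a p)) _.
apply: etrans (congr1 (HC_act^~ v) (esym (HC_piD (a *: p) q))) _.
apply: etrans (HC_act_pi _ _) (etrans (free_actP _ _ _ _) _).
by congr (_ *: _ + _); apply/esym/HC_act_pi.
Qed.

Lemma HC_actvP x a u v : HC_act x (a *: u + v) = a *: HC_act x u + HC_act x v.
Proof. exact: free_actvP. Qed.

Lemma HC_act1 v : HC_act 1 v = v.
Proof. by rewrite HC_act_pi free_act1. Qed.

Lemma HC_act_T i v : HC_act (HC_T K i) v = g (inl i) v.
Proof. by rewrite HC_act_pi free_act_T. Qed.

Lemma HC_act_c j v : HC_act (HC_c K j) v = g (inr j) v.
Proof. by rewrite HC_act_pi free_act_c. Qed.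

(** Commuting with the letters suffices. This serves for right multiplications in [HC_universal] and
    for value sorting in [rep_act_value]. *)
Lemma HC_act_commutant (h : {linear V -> V}) :
  (forall x v, g x (h v) = h (g x v)) -> forall x v, HC_act x (h v) = h (HC_act x v).
Proof.
move=> gh x v; rewrite /HC_act /free_act linear_sum; apply: eq_bigr => w _.
rewrite linearZ /=; congr (_ *: _).
by elim: (w : seq _) => //= y u ->; rewrite gh.
Qed.

End FreeAction.

(** * Relations and universal property *)

Lemma twist_rel (R : pzRingType) (t c d : R) :
  (t + 1) * d = c * (t + 1) -> t * d = c * t + c - d.
Proof. by rewrite mulrDl mulrDr mul1r mulr1 => <-; rewrite addrK. Qed.

Section Words.
Variables (K : fieldType) (n : nat).
Local Notation A := (HC K n).
Local Notation F := (HC_free K n).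

Definition HC_let (x : HC_letter n) : A :=
  match x with inl i => HC_T K i | inr j => HC_c K j end.

Definition HC_word (w : seq (HC_letter n)) : A := \prod_(x <- w) HC_let x.

Lemma HC_pi_prod (p q : F) : \pi_A%qT (p * q) = (\pi_A%qT p : A) * \pi_A%qT q.
Proof. exact: esym (HC_pi_mul p q). Qed.

Lemma HC_pi_word (w : {fmonom (HC_letter n)}) : \pi_A%qT (<< w >> : F) = HC_word w.
Proof.
case: w => w; elim: w => [|x w IH] /=.
  by rewrite /HC_word big_nil -fmoneE.
rewrite /HC_word big_cons -[X in _ = _ * X]IH.
have -> : FMonom (x :: w) = mmul (fmu x) (FMonom w) :> {fmonom (HC_letter n)}.
  by apply/eqP; rewrite fmP fmM fmU.
have -> : (<< mmul (fmu x) (FMonom w) >> : F) = << fmu x >> * << FMonom w >>.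
  by rewrite malgM_def fgmulUU mulr1.
by apply: etrans (HC_pi_prod _ _) _; case: x.
Qed.

Lemma HC_pi_sum (p : F) : \pi_A%qT p = \sum_(w <- msupp p) p@_w *: HC_word w.
Proof.
rewrite {1}[p]monalgE raddf_sum; apply: eq_bigr => w _.
rewrite -HC_pi_word; apply: etrans _ (esym (HC_pi_scale _ _)); congr (\pi_A%qT _).
by rewrite -mul_malgC malgM_def fgmulUU mulr1 mul1m.
Qed.

Lemma HC_word_ind (P : A -> Prop) :
  P 0 -> (forall a x y, P x -> P y -> P (a *: x + y)) ->
  (forall w, P (HC_word w)) -> forall x, P x.
Proof.
move=> P0 PD Pw; elim/quotW=> p; rewrite HC_pi_sum.
by elim: (enum_fset _) => [|w r IH]; rewrite ?big_nil // big_cons; apply: PD.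
Qed.

Lemma HC_ind (P : A -> Prop) :
  P 1 -> (forall a x y, P x -> P y -> P (a *: x + y)) ->
  (forall i x, P x -> P (HC_T K i * x)) -> (forall j x, P x -> P (HC_c K j * x)) ->
  forall x, P x.
Proof.
move=> P1 PD PT Pc; apply: HC_word_ind => // [|w].
  by rewrite -(subrr 1) addrC -scaleN1r; apply: PD.
elim: w => [|x w IH]; first by rewrite /HC_word big_nil.
by rewrite /HC_word big_cons; case: x => [i|j]; [apply: PT|apply: Pc].
Qed.

Lemma HC_rel_eq (l r : F) : HC_rel l r -> \pi_A%qT l = \pi_A%qT r.
Proof. by move=> lr; apply/eqP/HC_eqP; apply: HC_ideal_rel. Qed.

Lemma HC_piN (p : F) : \pi_A%qT (- p) = - \pi_A%qT p :> A.
Proof. exact: raddfN. Qed.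

Lemma HC_piD1 (p : F) : \pi_A%qT (p + 1) = (\pi_A%qT p : A) + 1.
Proof. exact: HC_piD. Qed.

Lemma HC_pi_prod3 (p q r : F) :
  \pi_A%qT (p * q * r) = (\pi_A%qT p : A) * \pi_A%qT q * \pi_A%qT r.
Proof. exact: etrans (HC_pi_prod _ _) (congr1 ( *%R^~ _) (HC_pi_prod _ _)). Qed.

Lemma HC_TT i : HC_T K i * HC_T K i = - HC_T K i :> A.
Proof.
have E := HC_rel_eq (HC_rel_TT K i).
have E1 := HC_pi_prod (free_T K i) (free_T K i).
exact (etrans (esym E1) (etrans E (HC_piN (free_T K i)))).
Qed.

Lemma HC_TTcomm (i j : 'I_n.-1) : (i.+1 < j)%N || (j.+1 < i)%N ->
  HC_T K i * HC_T K j = HC_T K j * HC_T K i :> A.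
Proof.
move=> far; have E := HC_rel_eq (HC_rel_TTcomm K far).
have E1 := HC_pi_prod (free_T K i) (free_T K j).
have E2 := HC_pi_prod (free_T K j) (free_T K i).
exact (etrans (esym E1) (etrans E E2)).
Qed.

Lemma HC_braid (i j : 'I_n.-1) : j = i.+1 :> nat ->
  HC_T K i * HC_T K j * HC_T K i = HC_T K j * HC_T K i * HC_T K j :> A.
Proof.
move=> Eij; have E := HC_rel_eq (HC_rel_braid K Eij).
have E1 := HC_pi_prod3 (free_T K i) (free_T K j) (free_T K i).
have E2 := HC_pi_prod3 (free_T K j) (free_T K i) (free_T K j).
exact (etrans (esym E1) (etrans E E2)).
Qed.

Lemma HC_cc j : HC_c K j * HC_c K j = - 1 :> A.
Proof.
have E := HC_rel_eq (HC_rel_cc K j).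
have E1 := HC_pi_prod (free_c K j) (free_c K j).
exact (etrans (esym E1) (etrans E (HC_piN 1))).
Qed.

Lemma HC_ccanti (i j : 'I_n) : i != j -> HC_c K i * HC_c K j = - (HC_c K j * HC_c K i) :> A.
Proof.
move=> neq; have E := HC_rel_eq (HC_rel_ccanti K neq).
have E1 := HC_pi_prod (free_c K i) (free_c K j).
have E2 := HC_pi_prod (free_c K j) (free_c K i).
have E3 := HC_piN (free_c K j * free_c K i).
exact (etrans (esym E1) (etrans E (etrans E3 (congr1 -%R E2)))).
Qed.

Lemma HC_Tccomm (i : 'I_n.-1) j : j != adjl i -> j != adjr i ->
  HC_T K i * HC_c K j = HC_c K j * HC_T K i :> A.
Proof.
move=> nl nr; have E := HC_rel_eq (HC_rel_Tccomm K nl nr).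
have E1 := HC_pi_prod (free_T K i) (free_c K j).
have E2 := HC_pi_prod (free_c K j) (free_T K i).
exact (etrans (esym E1) (etrans E E2)).
Qed.

Lemma HC_Tcl (i : 'I_n.-1) :
  HC_T K i * HC_c K (adjl i) = HC_c K (adjr i) * HC_T K i :> A.
Proof.
have E := HC_rel_eq (HC_rel_Tcl K i).
have E1 := HC_pi_prod (free_T K i) (free_c K (adjl i)).
have E2 := HC_pi_prod (free_c K (adjr i)) (free_T K i).
exact (etrans (esym E1) (etrans E E2)).
Qed.

Lemma HC_Tcr (i : 'I_n.-1) : HC_T K i * HC_c K (adjr i) =
  HC_c K (adjl i) * HC_T K i + HC_c K (adjl i) - HC_c K (adjr i) :> A.
Proof.
apply: twist_rel.
have E := HC_rel_eq (HC_rel_Tcr K i).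
have E1 := HC_pi_prod (free_T K i + 1) (free_c K (adjr i)).
have E2 := HC_pi_prod (free_c K (adjl i)) (free_T K i + 1).
have E3 := HC_piD1 (free_T K i).
have E4 := congr1 (fun t : A => t * HC_c K (adjr i)) E3.
have E5 := congr1 (fun t : A => HC_c K (adjl i) * t) E3.
exact (etrans (esym E4) (etrans (esym E1) (etrans E (etrans E2 E5)))).
Qed.

End Words.

Section UniversalProperty.
Variables (K : fieldType) (n : nat) (B : algType K).

Definition left_mul (a x : B) : B := a * x.
Lemma left_mul_linear a : linear (left_mul a).
Proof. by move=> k x y; rewrite /left_mul mulrDr scalerAr. Qed.
HB.instance Definition _ a := GRing.isLinear.Build K B B _ (left_mul a) (left_mul_linear a).

Definition right_mul (a x : B) : B := x * a.
Lemma right_mul_linear a : linear (right_mul a).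
Proof. by move=> k x y; rewrite /right_mul mulrDl scalerAl. Qed.
HB.instance Definition _ a := GRing.isLinear.Build K B B _ (right_mul a) (right_mul_linear a).

Variables (T : 'I_n.-1 -> B) (c : 'I_n -> B).

(** The target becomes a module by left multiplication, and the morphism is the orbit map of 1. It
    is multiplicative because the action commutes with right multiplications. *)
Lemma HC_universal :
  (forall i, T i * T i = - T i) ->
  (forall (i j : 'I_n.-1), (i.+1 < j)%N || (j.+1 < i)%N -> T i * T j = T j * T i) ->
  (forall (i j : 'I_n.-1), j = i.+1 :> nat -> T i * T j * T i = T j * T i * T j) ->
  (forall j, c j * c j = - 1) ->
  (forall i j, i != j -> c i * c j = - (c j * c i)) ->
  (forall i j, j != adjl i -> j != adjr i -> T i * c j = c j * T i) ->
  (forall i, T i * c (adjl i) = c (adjr i) * T i) ->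
  (forall i, T i * c (adjr i) = c (adjl i) * T i + c (adjl i) - c (adjr i)) ->
  exists phi : {lrmorphism HC K n -> B},
    (forall i, phi (HC_T K i) = T i) /\ (forall j, phi (HC_c K j) = c j).
Proof.
move=> TT Tf Tb cc ca Tc Tl Tr.
pose g (x : HC_letter n) : {linear B -> B} :=
  match x with inl i => left_mul (T i) | inr j => left_mul (c j) end.
have gP : HC_action g.
  apply: HC_actionP => [i v|i j H v|i j H v|j v|i j H v|i j H H' v|i v|i v];
    rewrite /= /left_mul !mulrA.
  - by rewrite TT mulNr.
  - by rewrite Tf.
  - by rewrite Tb.
  - by rewrite cc mulN1r.
  - by rewrite ca // mulNr.
  - by rewrite Tc.
  - by rewrite Tl.
  by rewrite Tr mulrBl mulrDl subrK.
pose f (x : HC K n) : B := HC_act g x 1.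
have fL : linear f by move=> a x y; rewrite /f HC_actP.
have fM : monoid_morphism f.
  split=> [|x y]; first exact: HC_act1.
  rewrite /f HC_actM // -{1}[HC_act g y 1]mul1r.
  apply: (HC_act_commutant (h := right_mul (HC_act g y 1))) => -[i|j] v;
    exact: mulrA.
pose M := GRing.isLinear.Build K (HC K n) B _ f fL.
pose M' := GRing.isMonoidMorphism.Build _ _ f fM.
pose phi : {lrmorphism HC K n -> B} := HB.pack f M M'.
exists phi; split=> [i|j]; [rewrite /= /f HC_act_T|rewrite /= /f HC_act_c] => //=; exact: mulr1.
Qed.

End UniversalProperty.

(** * The induced representation *)

Section Representation.
Variables (K : fieldType) (n : nat).
Local Notation E := {ffun 'I_n -> bool}.
Local Notation V := {ffun E * 'S_n -> K^o}.
Import Nontrivial.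
Implicit Types (i : 'I_n.-1) (j k : 'I_n) (e : E) (x : 'S_n) (f : V).

Definition swap_adj i e : E := [ffun k => e (simple_refl i k)].

Definition fiber f x : E -> K := fun e => f (e, x).

(** This is the leading term of [T_i] on c_e. One sign comes from [T_i] being minus a sorting
    operator; reordering c_i c_(i+1) after the exchange contributes a second one, which cancels the
    first exactly when both letters occur. *)
Definition rep_sort i f : V := [ffun p : E * 'S_n =>
  (-1) ^+ (~~ (p.1 (adjl i) && p.1 (adjr i))) * f (swap_adj i p.1, sort_step i p.2)].

Definition rep_cliff (l : HC_letter n) f : V := [ffun p : E * 'S_n => act1 l (fiber f p.2) p.1].

(** Moving [T_i] to the right past c_e gives a multiple of c_(s_i e) T_i, realised by [rep_sort],
    plus purely Clifford terms, realised by [rep_cliff]. *)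
Definition rep (l : HC_letter n) f : V :=
  if l is inl i then rep_sort i f + rep_cliff l f else rep_cliff l f.

Arguments rep : simpl never.

Lemma rep_sort_linear i : linear (rep_sort i).
Proof. by move=> a f g; apply/ffunP=> p; rewrite !ffunE mulrDr /GRing.scale /= mulrCA. Qed.
HB.instance Definition _ i := GRing.isLinear.Build K V V *:%R (rep_sort i) (rep_sort_linear i).

Lemma rep_cliff_linear l : linear (rep_cliff l).
Proof.
by move=> a f g; apply/ffunP=> p; rewrite !ffunE /act1 /fiber !ffunE mulrDr /GRing.scale /= mulrCA.
Qed.
HB.instance Definition _ l := GRing.isLinear.Build K V V *:%R (rep_cliff l) (rep_cliff_linear l).

Lemma rep_linear l : linear (rep l).
Proof.
case: l => [i|j] a f g; rewrite /rep linearP //= linearP scalerDr addrACA //.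
Qed.
HB.instance Definition _ l := GRing.isLinear.Build K V V *:%R (rep l) (rep_linear l).

Lemma act1_ext l (h h' : E -> K) e : h =1 h' -> act1 l h e = act1 l h' e.
Proof. by move=> H; rewrite /act1 H. Qed.

Lemma rep_cliff2 l l' f e x :
  rep_cliff l (rep_cliff l' f) (e, x) = act1 l (act1 l' (fiber f x)) e.
Proof. by rewrite ffunE; apply: act1_ext => e'; rewrite /fiber ffunE. Qed.

Lemma rep_cliffE l f e x : rep_cliff l f (e, x) = act1 l (fiber f x) e.
Proof. by rewrite ffunE. Qed.

(** Exposes the bits of [e] at i and i+1, so that the relations among the [T_i] become finite checks
    over these bits. *)
Definition set_adj i e (a b : bool) : E :=
  [ffun k => if k == adjl i then a else if k == adjr i then b else e k].

Lemma set_adjl i e a b : set_adj i e a b (adjl i) = a.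
Proof. by rewrite ffunE eqxx. Qed.

Lemma set_adjr i e a b : set_adj i e a b (adjr i) = b.
Proof. by rewrite ffunE eq_sym (negPf (adjl_neq_adjr i)) eqxx. Qed.

Lemma set_adj_id i e : set_adj i e (e (adjl i)) (e (adjr i)) = e.
Proof. by apply/ffunP=> k; rewrite ffunE; case: eqP => [->|_] //; case: eqP => [->|]. Qed.

Lemma swap_set_adj i e a b : swap_adj i (set_adj i e a b) = set_adj i e b a.
Proof.
apply/ffunP=> k; rewrite !ffunE simple_reflE.
have n1 := negPf (adjl_neq_adjr i); have n2 : (adjr i == adjl i) = false by rewrite eq_sym.
case: (eqVneq k (adjl i)) => [_|nl]; first by rewrite eqxx n2.
by case: (eqVneq k (adjr i)) => [_|nr]; rewrite ?eqxx ?(negPf nl) ?(negPf nr).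
Qed.

Lemma flip_set_adj i e a b :
  flip (adjl i) (flip (adjr i) (set_adj i e a b)) = set_adj i e (~~ a) (~~ b).
Proof.
apply/ffunP=> k; rewrite !ffunE.
have n1 := negPf (adjl_neq_adjr i); have n2 : (adjr i == adjl i) = false by rewrite eq_sym.
case: (eqVneq k (adjl i)) => [->|nl]; first by rewrite n1 addbF addbT.
by case: (eqVneq k (adjr i)) => [_|nr]; rewrite ?addbF ?addbT.
Qed.

Lemma rep_TE i f e a b x : rep (inl i) f (set_adj i e a b, x) =
  (-1) ^+ (~~ (a && b)) * f (set_adj i e b a, sort_step i x)
  + (-1) ^+ b * f (if b then set_adj i e a b else set_adj i e (~~ a) (~~ b), x) :> K.
Proof.
rewrite /rep ffunE [X in X + _]ffunE rep_cliffE /act1 /fiber /= set_adjl set_adjr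
  swap_set_adj flip_set_adj.
by case: b.
Qed.

Lemma rep_TT i f : rep (inl i) (rep (inl i) f) = - rep (inl i) f.
Proof.
apply/ffunP=> -[e x]; rewrite -(set_adj_id i e) [RHS]ffunE.
by case: (e (adjl i)); case: (e (adjr i));
  do 2?rewrite !rep_TE /=; rewrite ?sort_stepK; ring.
Qed.

Section Far.
Variables i j : 'I_n.-1.
Hypothesis far : (i.+1 < j)%N || (j.+1 < i)%N.

Lemma set_adjC e a b c d :
  set_adj i (set_adj j e c d) a b = set_adj j (set_adj i e a b) c d.
Proof.
apply/ffunP=> k; rewrite !ffunE.
case: (eqVneq k (adjl i)) => [->|_]; first by rewrite !ifN // -val_eqE /=; move: far; lia.
case: (eqVneq k (adjr i)) => [->|_] //; by rewrite !ifN // -val_eqE /=; move: far; lia.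
Qed.

Lemma rep_TE_far f e a b c d x : rep (inl j) f (set_adj i (set_adj j e c d) a b, x) =
  (-1) ^+ (~~ (c && d)) * f (set_adj i (set_adj j e d c) a b, sort_step j x)
  + (-1) ^+ d * f (if d then set_adj i (set_adj j e c d) a b
                  else set_adj i (set_adj j e (~~ c) (~~ d)) a b, x) :> K.
Proof. by rewrite set_adjC rep_TE -!set_adjC. Qed.

Lemma rep_TTcomm f :
  rep (inl i) (rep (inl j) f) = rep (inl j) (rep (inl i) f).
Proof.
apply/ffunP=> -[e x].
have -> : e = set_adj i (set_adj j e (e (adjl j)) (e (adjr j))) (e (adjl i)) (e (adjr i)).
  by rewrite !set_adj_id.
case: (e (adjl i)); case: (e (adjr i)); case: (e (adjl j)); case: (e (adjr j));
  do 2?rewrite !(rep_TE, rep_TE_far) /=; rewrite (sort_step_far _ far); ring.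
Qed.

End Far.

Section Braid.
Variables i j : 'I_n.-1.
Hypothesis Eij : j = i.+1 :> nat.

Definition set_adj3 e a b c : E := [ffun k => if k == adjl i then a else
  if k == adjr i then b else if k == adjr j then c else e k].

Lemma set_adj3_id e : set_adj3 e (e (adjl i)) (e (adjr i)) (e (adjr j)) = e.
Proof.
by apply/ffunP=> k; rewrite ffunE; case: eqP => [->|_] //; case: eqP => [->|_] //;
  case: eqP => [->|].
Qed.

Lemma set_adj3l e a b c a' b' : set_adj i (set_adj3 e a b c) a' b' = set_adj3 e a' b' c.
Proof. by apply/ffunP=> k; rewrite !ffunE; case: (k == adjl i); case: (k == adjr i). Qed.

Lemma set_adj3r e a b c b' c' : set_adj j (set_adj3 e a b c) b' c' = set_adj3 e a b' c'.
Proof.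
apply/ffunP=> k; rewrite !ffunE (adjl_next Eij).
case El: (k == adjl i); first by rewrite (eqP El) !(adj_next_neq Eij).
by case: (k == adjr i); case: (k == adjr j).
Qed.

Lemma rep_TE3l f e a b c x : rep (inl i) f (set_adj3 e a b c, x) =
  (-1) ^+ (~~ (a && b)) * f (set_adj3 e b a c, sort_step i x)
  + (-1) ^+ b * f (if b then set_adj3 e a b c else set_adj3 e (~~ a) (~~ b) c, x) :> K.
Proof. by rewrite -[set_adj3 e a b c](set_adj3l e a b c) rep_TE !set_adj3l. Qed.

Lemma rep_TE3r f e a b c x : rep (inl j) f (set_adj3 e a b c, x) =
  (-1) ^+ (~~ (b && c)) * f (set_adj3 e a c b, sort_step j x)
  + (-1) ^+ c * f (if c then set_adj3 e a b c else set_adj3 e a (~~ b) (~~ c), x) :> K.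
Proof. by rewrite -[set_adj3 e a b c](set_adj3r e a b c) rep_TE !set_adj3r. Qed.

Lemma rep_braid f : rep (inl i) (rep (inl j) (rep (inl i) f)) =
  rep (inl j) (rep (inl i) (rep (inl j) f)).
Proof.
apply/ffunP=> -[e x]; rewrite -(set_adj3_id e).
by case: (e (adjl i)); case: (e (adjr i)); case: (e (adjr j));
  do 3?rewrite !(rep_TE3l, rep_TE3r) /=;
  rewrite ?sort_stepK ?(sort_step_braid Eij); ring.
Qed.

End Braid.

Lemma par_swap i k e : k != adjr i -> par k (swap_adj i e) = par k e.
Proof.
move=> nk; rewrite /par [RHS](reindex_inj (inv_inj (simple_reflK i))) /=.
apply: eq_big => [m|m _]; last by rewrite ffunE.
rewrite simple_reflE; move: nk; rewrite -!val_eqE /=.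
by do 3?case: eqP => /=; lia.
Qed.

(** The sorting part satisfies the homogeneous relation T c_k = c_(s_i k) T on the nose. In the
    mixed relations the inhomogeneous terms are thus accounted for by the Clifford part alone, where
    they are already known from [act1_Tcl] and [act1_Tcr]. *)
Lemma rep_sort_c i k f :
  rep_sort i (rep_cliff (inr k) f) = rep_cliff (inr (simple_refl i k)) (rep_sort i f).
Proof.
apply/ffunP=> -[e x]; rewrite ffunE /= rep_cliffE [RHS]ffunE /act1 /fiber ffunE /=.
rewrite !mulrA -!signr_addb; congr (_ ^+ _ * f (_, _)); last first.
  by apply/ffunP=> m; rewrite !ffunE (inj_eq perm_inj).
rewrite !ffunE; have n1 := adjl_neq_adjr i.
have [->|nl] := eqVneq k (adjl i).
  rewrite simple_refl_adjl par_adjr par_swap // eqxx (negPf n1).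
  by case: (par _ _); case: (e (adjl i)); case: (e (adjr i)).
have [->|nr] := eqVneq k (adjr i).
  rewrite simple_refl_adjr par_adjr par_swap // eqxx ffunE simple_refl_adjl eq_sym (negPf n1).
  by case: (par _ _); case: (e (adjl i)); case: (e (adjr i)).
rewrite simple_reflE (negPf nl) (negPf nr) par_swap // !(eq_sym _ k) (negPf nl) (negPf nr) !addbF.
by rewrite addbC.
Qed.

Lemma rep_action : HC_action (fun l => rep l : {linear V -> V}).
Proof.
apply: HC_actionP; rewrite /= /rep.
- by move=> i f; exact: rep_TT.
- by move=> i j far f; apply: rep_TTcomm.
- by move=> i j Eij f; apply: rep_braid.
- by move=> j f; apply/ffunP=> -[e x]; rewrite rep_cliff2 act1_cc [RHS]ffunE.
- move=> i j neq f; apply/ffunP=> -[e x].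
  by rewrite rep_cliff2 act1_ccanti // [RHS]ffunE rep_cliff2.
- move=> i j nl nr f; rewrite rep_sort_c linearD /= simple_reflE (negPf nl) (negPf nr).
  by congr (_ + _); apply/ffunP=> -[e x]; rewrite !rep_cliff2 act1_Tccomm.
- move=> i f; rewrite rep_sort_c linearD /= simple_refl_adjl.
  by congr (_ + _); apply/ffunP=> -[e x]; rewrite !rep_cliff2 act1_Tcl.
move=> i f; rewrite rep_sort_c linearD /= simple_refl_adjr -!addrA; congr (_ + _).
apply/ffunP=> -[e x].
by rewrite ffunE [RHS]ffunE !rep_cliff2 !rep_cliffE act1_Tcr.
Qed.

End Representation.

(** * Spanning set and automorphisms *)

Definition reduced_word n (w : 'S_n) : seq 'I_n.-1 := sval (cid (inv_word w)).

Lemma reduced_wordP n (w : 'S_n) : reduced_expression (reduced_word w) w.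
Proof. by rewrite reducedE; apply: (svalP (cid (inv_word w))). Qed.

Section Presented.
Variables (K : fieldType) (n : nat) (A : algType K).
Variables (T : 'I_n.-1 -> A) (c : 'I_n -> A).
Implicit Types (i : 'I_n.-1) (j k : 'I_n) (s t : seq 'I_n.-1) (u v : seq 'I_n).

Hypothesis TT : forall i, T i * T i = - T i.
Hypothesis TTcomm : forall (i j : 'I_n.-1), (i.+1 < j)%N || (j.+1 < i)%N -> T i * T j = T j * T i.
Hypothesis Tbraid : forall (i j : 'I_n.-1), j = i.+1 :> nat -> T i * T j * T i = T j * T i * T j.

Definition Tword s : A := \prod_(i <- s) T i.

Lemma Tword_cons i s : Tword (i :: s) = T i * Tword s.
Proof. exact: big_cons. Qed.

(** Matsumoto's theorem, by induction on the length of [w]. Reduced words with distinct first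
    letters are compared through auxiliary reduced words that begin with the two sides of a
    commutation or braid relation and share the same tail. *)
Lemma Tword_matsumoto s t w :
  reduced_expression s w -> reduced_expression t w -> Tword s = Tword t.
Proof.
have [d] := ubnP (ninv w); elim: d s t w => // d IH s t w ltd.
have sr_neq (i : 'I_n.-1) (y : 'S_n) : ~~ (y (adjl i) < y (adjr i))%N ->
    (ninv (simple_refl i * y)%g < ninv y)%N.
  by move/inv_simple_refl_desc->.
have next (i j : 'I_n.-1) s' t' : j = i.+1 :> nat ->
    reduced_expression (i :: s') w -> reduced_expression (j :: t') w ->
    Tword (i :: s') = Tword (j :: t').
  move=> Eij /reduced_consP[rs di] /reduced_consP[rt dj].
  (* The common tail: what remains of [w] after the prefix i j i, or equally j i j, is stripped
     off. *)
  pose r := reduced_word (simple_refl i * (simple_refl j * (simple_refl i * w)))%g.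
  have Eb : (simple_refl i * (simple_refl j * (simple_refl i * w)) =
     simple_refl j * (simple_refl i * (simple_refl j * w)))%g.
    by rewrite !mulgA (simple_refl_braid Eij).
  have EV := (permM, simple_refl_next Eij, simple_refl_adjl, simple_refl_adjr, adjl_next Eij).
  rewrite (adjl_next Eij) in dj.
  have rs' : reduced_expression [:: j, i & r] (simple_refl i * w)%g.
    apply: reduced_cons; first by rewrite !EV; move: di dj; lia.
    apply: reduced_cons; first by rewrite !EV; move: di dj; lia.
    exact: reduced_wordP.
  have rt' : reduced_expression [:: i, j & r] (simple_refl j * w)%g.
    apply: reduced_cons; first by rewrite !EV; move: di dj; lia.
    apply: reduced_cons; first by rewrite !EV; move: di dj; lia.
    by rewrite /r Eb; apply: reduced_wordP.
  rewrite Tword_cons (IH _ _ _ _ rs rs'); last by have := sr_neq _ _ di; lia.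
  rewrite -(adjl_next Eij) in dj.
  rewrite [RHS]Tword_cons (IH _ _ _ _ rt rt'); last by have := sr_neq _ _ dj; lia.
  by rewrite !Tword_cons !mulrA Tbraid.
case: s t => [|i s] [|j t] // rs rt.
- by move: rs rt => /reducedE[_ /= E] /reducedE[_ /=]; rewrite -E.
- by move: rs rt => /reducedE[_ /= E] /reducedE[_ /=]; rewrite -E.
have [/reduced_consP[rs' di] /reduced_consP[rt' dj]] := (rs, rt).
have [Eij|neq] := eqVneq i j.
  rewrite -{}Eij in rt' *; rewrite !Tword_cons (IH _ _ _ _ rs' rt') //.
  by have := sr_neq _ _ di; lia.
have [far|] := boolP ((i.+1 < j)%N || (j.+1 < i)%N); last first.
  move: neq; rewrite -val_eqE /= => neq near.
  have [E|E] : j = i.+1 :> nat \/ i = j.+1 :> nat by lia.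
    exact: next.
  exact: esym (next _ _ _ _ E rt rs).
have far' : (j.+1 < i)%N || (i.+1 < j)%N by rewrite orbC.
pose r := reduced_word (simple_refl j * (simple_refl i * w))%g.
have rs2 : reduced_expression (j :: r) (simple_refl i * w)%g.
  apply: reduced_cons; first by rewrite !permM !(simple_refl_far far).
  exact: reduced_wordP.
have rt2 : reduced_expression (i :: r) (simple_refl j * w)%g.
  apply: reduced_cons; first by rewrite !permM !(simple_refl_far far').
  by rewrite mulgA simple_refl_commute // -mulgA; apply: reduced_wordP.
rewrite !Tword_cons (IH _ _ _ _ rs' rs2); last by have := sr_neq _ _ di; lia.
rewrite (IH _ _ _ _ rt' rt2); last by have := sr_neq _ _ dj; lia.
by rewrite !Tword_cons !mulrA TTcomm.
Qed.

Hypothesis cc : forall j, c j * c j = - 1.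
Hypothesis ccanti : forall j k, j != k -> c j * c k = - (c k * c j).
Hypothesis Tccomm : forall i j, j != adjl i -> j != adjr i -> T i * c j = c j * T i.
Hypothesis Tcl : forall i, T i * c (adjl i) = c (adjr i) * T i.
Hypothesis Tcr : forall i, T i * c (adjr i) = c (adjl i) * T i + c (adjl i) - c (adjr i).

(** * The elements c_D T_w span *)

Section Span.
Hypothesis generated : forall P : A -> Prop,
  P 1 -> (forall a x y, P x -> P y -> P (a *: x + y)) ->
  (forall i x, P x -> P (T i * x)) -> (forall j x, P x -> P (c j * x)) -> forall x, P x.

Definition cword u : A := \prod_(j <- u) c j.

Lemma cword_cons j u : cword (j :: u) = c j * cword u.
Proof. exact: big_cons. Qed.

Lemma cword_swap u j : exists b : bool, cword u * c j = (-1) ^+ b *: (c j * cword u).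
Proof.
elim: u => [|k u [b IH]].
  by exists false; rewrite /cword big_nil mul1r mulr1 scale1r.
exists (b (+) (k != j)); rewrite cword_cons -mulrA IH -scalerAr !mulrA signr_addb -scalerA.
congr (_ *: _); have [->|neq] := eqVneq k j; first by rewrite scale1r.
by rewrite (ccanti neq) /= scaleN1r mulNr.
Qed.

Lemma cword_perm u v : perm_eq u v -> exists b : bool, cword u = (-1) ^+ b *: cword v.
Proof.
elim: u v => [|j u IH] v.
  by rewrite perm_sym => /perm_nilP ->; exists false; rewrite scale1r.
move=> uv; have : j \in v by rewrite -(perm_mem uv) mem_head.
move=> /splitPr vP; case: v / vP uv => v1 v2 uv.
have : perm_eq u (v1 ++ v2) 
  by rewrite -(perm_cons j); apply: perm_trans uv _; apply/permPl/(perm_catCA v1 [:: j] v2).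
case/IH => b E; have [b' E'] := cword_swap v1 j; exists (b (+) b').
rewrite cword_cons E -scalerAr /cword !big_cat /= big_cons -!/(cword _).
by rewrite [in RHS]mulrA E' -scalerAl scalerA -signr_addb addbK mulrA.
Qed.

Definition HC_basis (p : {set 'I_n} * 'S_n) : A :=
  (\prod_(j in p.1) c j) * Tword (reduced_word p.2).

Lemma cword_basis_Tword u D w t :
  cword u * (HC_basis (D, w) * Tword t) = cword (u ++ enum D) * Tword (reduced_word w ++ t).
Proof.
have -> : HC_basis (D, w) = cword (enum D) * Tword (reduced_word w).
  by rewrite /HC_basis -big_filter /cword /enum_mem /index_enum; case: index_enum_key.
by rewrite /cword /Tword !big_cat /= !mulrA.
Qed.

Lemma neg_c_cword j u (a : K) x :
  - c j * (a *: (cword u * x)) = - a *: (cword (j :: u) * x).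
Proof. by rewrite cword_cons mulNr -scalerAr mulrA scaleNr. Qed.

Lemma cword_double j x : cword [:: j; j] * x = - 1 *: x.
Proof. by rewrite /cword !big_cons big_nil mulr1 cc mulN1r scaleN1r. Qed.

Definition HC_span x := exists k : {set 'I_n} * 'S_n -> K, x = \sum_p k p *: HC_basis p.

Lemma cset_cword (D : {set 'I_n}) : \prod_(j in D) c j = cword (enum D).
Proof. by rewrite -big_filter /cword /enum_mem /index_enum; case: index_enum_key. Qed.

Lemma HC_span_lin a x y : HC_span x -> HC_span y -> HC_span (a *: x + y).
Proof.
move=> [k ->] [l ->]; exists (fun p => a * k p + l p).
rewrite scaler_sumr -big_split; apply: eq_bigr => p _.
by rewrite scalerDl scalerA.
Qed.

Lemma HC_span_basis p : HC_span (HC_basis p).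
Proof.
exists (fun q => (q == p)%:R); rewrite (bigD1 p) //= eqxx scale1r big1 ?addr0 //.
by move=> q /negPf ->; rewrite scale0r.
Qed.

Lemma HC_span0 : HC_span 0.
Proof. by exists (fun=> 0); rewrite big1 // => p _; rewrite scale0r. Qed.

Lemma HC_spanZ a x : HC_span x -> HC_span (a *: x).
Proof. by move=> sx; rewrite -[a *: x]addr0; apply: HC_span_lin => //; apply: HC_span0. Qed.

Lemma HC_spanD x y : HC_span x -> HC_span y -> HC_span (x + y).
Proof. by move=> sx sy; rewrite -[x]scale1r; apply: HC_span_lin. Qed.

Lemma HC_span_closed (f : A -> A) :
  (forall a x y, f (a *: x + y) = a *: f x + f y) ->
  (forall p, HC_span (f (HC_basis p))) -> forall x, HC_span x -> HC_span (f x).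
Proof.
move=> flin fb x [k ->].
have f0 : f 0 = 0 by have := flin (-1) 0 0; rewrite scaler0 addr0 scaleN1r addNr.
elim: (index_enum _) => [|p r IH]; first by rewrite big_nil f0; apply: HC_span0.
by rewrite big_cons flin; apply: HC_span_lin.
Qed.

Lemma HC_span_c j x : HC_span x -> HC_span (c j * x).
Proof.
apply: (HC_span_closed (f := fun x => c j * x)) => [a y z|[D w]].
  by rewrite mulrDr scalerAr.
rewrite /HC_basis /= cset_cword mulrA -cword_cons.
have [jD|jD] := boolP (j \in D).
  have : perm_eq (enum D) (j :: enum (D :\ j)).
    apply: uniq_perm => [||k]; rewrite /= ?enum_uniq ?mem_enum ?setD11 //.
    by rewrite inE !mem_enum !inE; have [->|] := eqVneq k j.
  case/cword_perm => b E; rewrite cword_cons E -scalerAr cword_cons mulrA cc mulN1r.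
  rewrite -scalerAl; apply: HC_spanZ; rewrite mulNr -scaleN1r; apply: HC_spanZ.
  by rewrite -cset_cword; apply: (HC_span_basis (D :\ j, w)).
have : perm_eq (j :: enum D) (enum (j |: D)).
  apply: uniq_perm => [||k]; rewrite /= ?enum_uniq ?mem_enum ?jD //.
  by rewrite inE !mem_enum !inE.
case/cword_perm => b ->; rewrite -scalerAl; apply: HC_spanZ.
by rewrite -cset_cword; apply: (HC_span_basis (j |: D, w)).
Qed.

Lemma HC_span_Tword w : HC_span (Tword (reduced_word w)).
Proof.
have := HC_span_basis (set0, w).
by rewrite /HC_basis /= big_set0 mul1r.
Qed.

(** [T_i] is pushed through the Clifford letters until it meets T_w. There an ascent gives a longer
    basis word, and a descent absorbs [T_i] up to sign, since T_w then has an expression starting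
    with [T_i]. *)
Lemma HC_span_T i x : HC_span x -> HC_span (T i * x).
Proof.
apply: (HC_span_closed (f := fun x => T i * x)) => [a y z|[D w]].
  by rewrite mulrDr scalerAr.
rewrite /HC_basis /= cset_cword.
suff base : HC_span (T i * Tword (reduced_word w)).
  (* Needed for the terms of [Tcr] in which [T_i] has disappeared. *)
  have sp u : HC_span (cword u * Tword (reduced_word w)).
    elim: u => [|j u IH]; last by rewrite cword_cons -mulrA; apply: HC_span_c.
    by rewrite /cword big_nil mul1r; apply: HC_span_Tword.
  elim: (enum D) => [|j u IH]; first by rewrite /cword big_nil mul1r.
  rewrite cword_cons -mulrA; set y := cword u * _ in IH *.
  have sy : HC_span y by apply: sp.
  rewrite mulrA; have [->|nl] := eqVneq j (adjl i).
    by rewrite Tcl -mulrA; apply: HC_span_c.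
  have [->|nr] := eqVneq j (adjr i); last first.
    by rewrite Tccomm // -mulrA; apply: HC_span_c.
  rewrite Tcr mulrBl mulrDl -mulrA addrC -scaleN1r.
  by apply: HC_span_lin; [|apply: HC_spanD]; apply: HC_span_c.
case: (boolP (w (adjl i) < w (adjr i))%N) => [asc|desc].
  rewrite -Tword_cons (_ : Tword _ = Tword (reduced_word (simple_refl i * w)%g)).
    exact: HC_span_Tword.
  apply: (Tword_matsumoto (w := (simple_refl i * w)%g)); last exact: reduced_wordP.
  apply: reduced_cons; last by rewrite simple_refl_mulK; apply: reduced_wordP.
  by rewrite !permM simple_refl_adjl simple_refl_adjr; move: asc; lia.
have E : Tword (reduced_word w) = Tword (i :: reduced_word (simple_refl i * w)%g).
  apply: (Tword_matsumoto (w := w)); first exact: reduced_wordP.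
  by apply: reduced_cons => //; apply: reduced_wordP.
rewrite E Tword_cons mulrA TT mulNr -scaleN1r -Tword_cons -E.
by apply: HC_spanZ; apply: HC_span_Tword.
Qed.

Lemma HC_spanP x : HC_span x.
Proof.
apply: generated => [|a y z|i y|j y]; last exact: HC_span_c.
- rewrite (_ : 1 = Tword (reduced_word 1%g)); first exact: HC_span_Tword.
  have /reducedE[_ /=] := reduced_wordP (1%g : 'S_n).
  by rewrite inv1 => /size0nil ->; rewrite /Tword big_nil.
- exact: HC_span_lin.
exact: HC_span_T.
Qed.

End Span.

(** * The twisted generators and their relations *)

Definition cc_adj i : A := c (adjl i) * c (adjr i).
Definition twist_T i : A := T i + cc_adj i.
(** Here [- T i] is idempotent and [- shift_T i] is the complementary idempotent. *)
Definition shift_T i : A := - (T i + 1).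

Lemma shift_TT i : shift_T i * shift_T i = - shift_T i.
Proof. by rewrite /shift_T mulrNN mulrDl mulrDr TT mulr1 mul1r addNr add0r opprK. Qed.

Lemma cc_adj_sq i : cc_adj i * cc_adj i = - 1.
Proof.
rewrite /cc_adj mulrA -[_ * c (adjl i)]mulrA [c (adjr i) * _]ccanti; last first.
  by rewrite eq_sym adjl_neq_adjr.
by rewrite mulrN mulrA cc mulN1r opprK cc.
Qed.

(* Conjugation by the Clifford volume element exchanges [T_i + c_i c_(i+1)] and [- (T_i + 1)]. *)
Lemma twist_cc_adj i : twist_T i * cc_adj i = cc_adj i * shift_T i.
Proof.
rewrite mulrDl cc_adj_sq /shift_T mulrN mulrDr mulr1.
rewrite /cc_adj mulrA Tcl -mulrA Tcr !(mulrBr, mulrDr) !mulrA cc.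
rewrite (ccanti (j := adjr i)); last by rewrite eq_sym adjl_neq_adjr.
by rewrite mulNr opprK addrK opprD.
Qed.

Lemma twist_TT i : twist_T i * twist_T i = - twist_T i.
Proof.
have E : twist_T i = - (cc_adj i * shift_T i * cc_adj i).
  by rewrite -twist_cc_adj -mulrA cc_adj_sq mulrN1 opprK.
rewrite E mulrNN opprK; move: (cc_adj_sq i) (shift_TT i).
move: (cc_adj i) (shift_T i) => C S CC SS.
rewrite -!mulrA [C * (C * _)]mulrA CC mulN1r mulrN.
by rewrite mulrN [S * (S * _)]mulrA SS mulNr mulrN !opprK.
Qed.

Lemma comm_cc_adj x i : (x * c (adjl i) = - (c (adjl i) * x)) ->
  (x * c (adjr i) = - (c (adjr i) * x)) -> x * cc_adj i = cc_adj i * x.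
Proof.
move=> El Er.
by rewrite /cc_adj mulrA El mulNr -[c (adjl i) * x * _]mulrA Er mulrN opprK mulrA.
Qed.

Lemma c_cc_adj i j : j != adjl i -> j != adjr i -> c j * cc_adj i = cc_adj i * c j.
Proof. by move=> nl nr; apply: comm_cc_adj; apply: ccanti. Qed.

Lemma twist_comm (i j : 'I_n.-1) : (i.+1 < j)%N || (j.+1 < i)%N ->
  twist_T i * twist_T j = twist_T j * twist_T i.
Proof.
have far_neq (k l : 'I_n.-1) : (k.+1 < l)%N || (l.+1 < k)%N ->
    [/\ adjl l != adjl k, adjl l != adjr k, adjr l != adjl k & adjr l != adjr k].
  by move=> far; rewrite -!val_eqE /=; split; move: far; lia.
have Tcc (k l : 'I_n.-1) : (k.+1 < l)%N || (l.+1 < k)%N -> T k * cc_adj l = cc_adj l * T k.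
  case/far_neq=> n1 n2 n3 n4.
  by rewrite /cc_adj mulrA Tccomm // -mulrA Tccomm // mulrA.
move=> far; have far' : (j.+1 < i)%N || (i.+1 < j)%N by rewrite orbC.
have [n1 n2 n3 n4] := far_neq _ _ far.
rewrite /twist_T !mulrDl !mulrDr (TTcomm far) (Tcc _ _ far) -(Tcc _ _ far') addrACA.
congr (_ + _ + (_ + _)).
by apply: commrM; apply: esym; apply: c_cc_adj.
Qed.

(** Once x * x = - x is used, every term of (x + 1)(y + 1)(x + 1) other than xyx is symmetric in x
    and y. *)
Lemma shift_braid (i j : 'I_n.-1) : j = i.+1 :> nat ->
  shift_T i * shift_T j * shift_T i = shift_T j * shift_T i * shift_T j.
Proof.
move=> Eij; rewrite /shift_T !mulrNN !mulrN; congr (- _).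
have expand (x y : A) : x * x = - x ->
    (x + 1) * (y + 1) * (x + 1) = x * y * x + (x * y + y * x) + (x + y) + 1.
  move=> xx; have E : (x + 1) * (y + 1) = x * y + y + (x + 1).
    by rewrite mulrDr mulr1 mulrDl mul1r.
  have Ex : (x + 1) * (y + 1) * x = x * y * x + y * x.
    by rewrite E !mulrDl mul1r xx addNr addr0.
  rewrite mulrDr mulr1 Ex E -!addrA; congr (_ + _).
  by rewrite addrCA; congr (_ + (_ + _)); rewrite addrCA.
by rewrite !expand ?TT // Tbraid // [T i * T j + _]addrC [T i + _]addrC.
Qed.

(** The product [C] of the three Clifford generators involved conjugates both twists into shifts at
    once. It contains [cc_adj] for either index, and the remaining factor commutes with the other
    elements concerned; so the relation is inherited from [shift_braid]. *)
Lemma twist_braid (i j : 'I_n.-1) : j = i.+1 :> nat ->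
  twist_T i * twist_T j * twist_T i = twist_T j * twist_T i * twist_T j.
Proof.
move=> Eij; pose C := cc_adj i * c (adjr j).
have neq := adj_next_neq Eij; have Ec := adjl_next Eij.
have EC : C = c (adjl i) * cc_adj j by rewrite /C /cc_adj Ec mulrA.
have CI : C * (c (adjr j) * cc_adj i) = 1.
  by rewrite /C -mulrA [c _ * (c _ * _)]mulrA cc mulN1r mulrN cc_adj_sq opprK.
have Ti : twist_T i * C = C * shift_T i.
  rewrite /C mulrA twist_cc_adj -mulrA -[RHS]mulrA; congr (_ * _).
  rewrite /shift_T mulNr mulrN mulrDl mulrDr mul1r mulr1 Tccomm //.
    by rewrite neq.
  by rewrite neq.
have Tj : twist_T j * C = C * shift_T j.
  have comm : twist_T j * c (adjl i) = c (adjl i) * twist_T j.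
    rewrite /twist_T mulrDl mulrDr Tccomm ?Ec ?neq //.
    by rewrite c_cc_adj // ?Ec neq.
  by rewrite EC mulrA comm -mulrA twist_cc_adj mulrA.
move: (twist_T i) (twist_T j) (shift_T i) (shift_T j) (shift_braid Eij) Ti Tj CI.
move: C (c _ * _) {EC} => C D x y x' y' br Ti Tj CD.
suff E : x * y * x * C = y * x * y * C by rewrite -[LHS]mulr1 -CD mulrA E -mulrA CD mulr1.
have conj z r z' r' : z * C = C * z' -> r * C = C * r' -> z * r * z * C = C * (z' * r' * z').
  by move=> Ez Er; rewrite -mulrA Ez mulrA -[z * r * C]mulrA Er mulrA -mulrA Ez -!mulrA.
by rewrite (conj _ _ _ _ Ti Tj) (conj _ _ _ _ Tj Ti) br.
Qed.

Lemma twist_mul i x : twist_T i * x = T i * x + c (adjl i) * (c (adjr i) * x).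
Proof. by rewrite mulrDl mulrA. Qed.

Lemma twist_cr i : twist_T i * c (adjr i) = c (adjl i) * twist_T i.
Proof.
rewrite /twist_T mulrDl mulrDr Tcr /cc_adj -[_ * c (adjr i) * _]mulrA cc mulrN1 mulrA cc mulN1r.
by rewrite -addrA -addrA; congr (_ + _); rewrite addrCA subrr addr0.
Qed.

Lemma twist_cl i : twist_T i * c (adjl i) =
  c (adjr i) * twist_T i + c (adjr i) - c (adjl i).
Proof.
have a : c (adjr i) * c (adjl i) = - (c (adjl i) * c (adjr i)).
  by rewrite ccanti // eq_sym adjl_neq_adjr.
rewrite /twist_T mulrDl mulrDr Tcl /cc_adj -!addrA; congr (_ + _).
rewrite mulrA a mulNr -!mulrA cc mulrN1 opprK addrCA subrr addr0.
by rewrite a mulrN mulrA cc mulN1r opprK.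
Qed.

Lemma twist_c i j : j != adjl i -> j != adjr i -> twist_T i * c j = c j * twist_T i.
Proof. by move=> nl nr; rewrite /twist_T mulrDl mulrDr Tccomm // c_cc_adj. Qed.

Lemma rev_adjl i : rev_ord (adjl i) = adjr (rev_ord i).
Proof. by apply: val_inj => /=; have := ltn_ord i; lia. Qed.

Lemma rev_adjr i : rev_ord (adjr i) = adjl (rev_ord i).
Proof. by apply: val_inj => /=; have := ltn_ord i; lia. Qed.

End Presented.

Lemma rmorph_sign_prod (K : fieldType) (A : algType K) (theta : {lrmorphism A -> A})
    (I : Type) (G : I -> A) (o : pred I) (u : seq I) :
  (forall l, theta (G l) = (-1) ^+ o l *: G l) ->
  theta (\prod_(l <- u) G l) = (-1) ^+ odd (count o u) *: \prod_(l <- u) G l.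
Proof.
move=> thetaG; elim: u => [|l u IH]; first by rewrite big_nil rmorph1 scale1r.
rewrite big_cons rmorphM /= IH thetaG -scalerAl -scalerAr scalerA -signr_addb.
by rewrite oddD oddb.
Qed.

Lemma theta_twist (K : fieldType) n (A : algType K) (T : 'I_n.-1 -> A) (c : 'I_n -> A)
    (theta : {lrmorphism A -> A}) :
  (forall i, theta (T i) = T i) -> (forall j, theta (c j) = - c j) ->
  forall i, theta (twist_T T c i) = twist_T T c i.
Proof. by move=> tT tc i; rewrite rmorphD rmorphM /= tT !tc mulrNN. Qed.

(** Reversing indices exchanges the two factors of c_i c_(i+1), so the second correction is the
    negative of the first. *)
Lemma twist_involutive (K : fieldType) n (A : algType K) (T : 'I_n.-1 -> A) (c : 'I_n -> A)
    (phi : {lrmorphism A -> A}) :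
  (forall j k, j != k -> c j * c k = - (c k * c j)) ->
  (forall i, phi (T i) = twist_T T c (rev_ord i)) ->
  (forall j, phi (c j) = - c (rev_ord j)) ->
  forall i, phi (phi (T i)) = T i.
Proof.
move=> ca phiT phic i; rewrite phiT rmorphD rmorphM /= phiT !phic mulrNN.
rewrite rev_adjl rev_adjr rev_ordK /twist_T /cc_adj -addrA (ca _ _ (adjl_neq_adjr i)).
by rewrite addNr addr0.
Qed.

Section Automorphisms.
Variables (K : fieldType) (n : nat).
Local Notation A := (HC K n).
Local Notation T := (@HC_T K n).
Local Notation c := (@HC_c K n).

Lemma HC_spanned (x : A) : HC_span T c x.
Proof.
exact: (HC_spanP (@HC_TT K n) (@HC_TTcomm K n) (@HC_braid K n) (@HC_cc K n)
  (@HC_ccanti K n) (@HC_Tccomm K n) (@HC_Tcl K n) (@HC_Tcr K n) (@HC_ind K n)).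
Qed.

(** The grading automorphism, whose eigenvalue equation characterises parity in [HC_parityP]. *)
Lemma HC_parity_automorphism : exists theta : {lrmorphism A -> A},
  (forall i, theta (T i) = T i) /\ (forall j, theta (c j) = - c j).
Proof.
apply: (HC_universal (T := T) (c := fun j => - c j)).
- exact: HC_TT.
- exact: HC_TTcomm.
- exact: HC_braid.
- by move=> j; rewrite mulrNN HC_cc.
- by move=> i j neq; rewrite !mulrNN HC_ccanti.
- by move=> i j nl nr; rewrite mulrN mulNr HC_Tccomm.
- by move=> i; rewrite mulrN mulNr HC_Tcl.
by move=> i; rewrite mulrN mulNr HC_Tcr !opprD.
Qed.

Lemma HC_nakayama_automorphism : exists phi : {lrmorphism A -> A},
  (forall i, phi (T i) = twist_T T c (rev_ord i)) /\ (forall j, phi (c j) = - c (rev_ord j)).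
Proof.
have TT := @HC_TT K n; have TTc := @HC_TTcomm K n; have Tb := @HC_braid K n.
have cc := @HC_cc K n; have ca := @HC_ccanti K n; have Tc := @HC_Tccomm K n.
have Tl := @HC_Tcl K n; have Tr := @HC_Tcr K n.
apply: (HC_universal (T := fun i => twist_T T c (rev_ord i)) (c := fun j => - c (rev_ord j))).
- by move=> i; apply: twist_TT.
- move=> i j far; apply: twist_comm => //=.
  by have := ltn_ord i; have := ltn_ord j; move: far; lia.
(* Reversal turns an increasing adjacent pair into a decreasing one, so the sides are exchanged. *)
- move=> i j Eij; apply: esym; apply: twist_braid => //=.
  by have := ltn_ord i; have := ltn_ord j; move: Eij; lia.
- by move=> j; rewrite mulrNN cc.
- by move=> i j neq; rewrite !mulrNN ca // (inj_eq rev_ord_inj).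
- move=> i j nl nr; rewrite mulrN mulNr twist_c //.
    by rewrite -rev_adjr (inj_eq rev_ord_inj).
  by rewrite -rev_adjl (inj_eq rev_ord_inj).
- by move=> i; rewrite mulrN mulNr rev_adjl rev_adjr twist_cr.
by move=> i; rewrite mulrN mulNr rev_adjl rev_adjr twist_cl // !opprD.
Qed.

End Automorphisms.

(** * The trace *)

Section Trace.
Variables (K : fieldType) (n : nat).
Local Notation A := (HC K n).
Local Notation T := (@HC_T K n).
Local Notation c := (@HC_c K n).
Local Notation E := {ffun 'I_n -> bool}.
Local Notation V := {ffun E * 'S_n -> K^o}.
Import Nontrivial.
Implicit Types (i : 'I_n.-1) (j k : 'I_n) (e : E) (w : 'S_n) (f g : V)
  (s t : seq 'I_n.-1) (u v : seq 'I_n) (D : {set 'I_n}).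

Definition rep_act (a : A) f : V := HC_act (fun l => rep l : {linear V -> V}) a f.

Lemma rep_actM (a b : A) f : rep_act (a * b) f = rep_act a (rep_act b f).
Proof. exact: (HC_actM (@rep_action K n)). Qed.

Lemma rep_act1 f : rep_act 1 f = f.
Proof. exact: (HC_act1 (@rep_action K n)). Qed.

Lemma rep_act_T i f : rep_act (T i) f = rep (inl i) f.
Proof. exact: (HC_act_T (@rep_action K n)). Qed.

Lemma rep_act_c j f : rep_act (c j) f = rep (inr j) f.
Proof. exact: (HC_act_c (@rep_action K n)). Qed.

Lemma rep_actvZ a (x : A) f : rep_act x (a *: f) = a *: rep_act x f.
Proof.
rewrite -[a *: f]addr0 /rep_act HC_actvP /HC_act free_actv0 addr0 //.
Qed.

Lemma rep_actP a (x y : A) f : rep_act (a *: x + y) f = a *: rep_act x f + rep_act y f.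
Proof. exact: (HC_actP (@rep_action K n)). Qed.

Lemma rep_actD (x y : A) f : rep_act (x + y) f = rep_act x f + rep_act y f.
Proof.
rewrite -[X in _ = X + _]scale1r -rep_actP.
by congr (rep_act (_ + _) _); apply/esym/scale1r.
Qed.

Definition e0 : E := [ffun=> false].

(** Functions supported on the empty Clifford monomial; words in the [T_i] preserve this space
    ([rep_Tword]). *)
Definition vacuum (h : 'S_n -> K) : V := [ffun p => (p.1 == e0)%:R * h p.2].

Lemma vacuumE h e x : vacuum h (e, x) = (e == e0)%:R * h x :> K.
Proof. exact: ffunE. Qed.

Definition top_vector : V := vacuum (fun x => (x == w0 n)%:R).

(** The sign compensates the factor (-1)^(size s) that a reduced word [s] of [w0] produces. *)
Definition HC_tr (a : A) : K := (-1) ^+ ninv (w0 n) * rep_act a top_vector (e0, 1%g).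

Lemma HC_tr_scalar : scalar HC_tr.
Proof.
move=> a x y; rewrite /HC_tr rep_actP !ffunE mulrDr; congr (_ + _).
exact: mulrCA.
Qed.
HB.instance Definition _ := GRing.isLinear.Build K A K *%R HC_tr HC_tr_scalar.

(** The Clifford part of [T_i] only reads values at points whose bit i+1 is set, and there the
    function vanishes. *)
Lemma rep_vacuum i h : rep (inl i) (vacuum h) = vacuum (fun x => - h (sort_step i x)).
Proof.
apply/ffunP=> -[e x]; rewrite -(set_adj_id i e) rep_TE.
set a := e (adjl i); set b := e (adjr i); clearbody a b.
have nz a' b' : a' || b' -> (set_adj i e a' b' == e0) = false.
  move=> ab; apply/eqP => /ffunP H; move: (H (adjl i)) (H (adjr i)).
  by rewrite set_adjl set_adjr !ffunE => Ea Eb; rewrite Ea Eb in ab.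
rewrite !vacuumE; case: a; case: b;
  rewrite /= ?vacuumE !(nz true true, nz true false, nz false true) //;
  by rewrite ?mulr0n !(mul0r, mulr0, addr0) // mulN1r mulrN.
Qed.

Lemma rep_Tword s h : rep_act (Tword T s) (vacuum h) =
  vacuum (fun x => (-1) ^+ size s * h (sort_word s x)).
Proof.
elim: s => [|i s IH].
  rewrite /Tword big_nil rep_act1; apply/ffunP=> -[e x].
  by rewrite !vacuumE /= mul1r.
rewrite Tword_cons rep_actM IH rep_act_T rep_vacuum.
by apply/ffunP=> -[e x]; rewrite !vacuumE /= exprS mulN1r mulNr.
Qed.

Definition flips u e : E := foldl (fun e j => flip j e) e u.

Lemma rep_cword u e : exists b : bool, forall g x,
  rep_act (cword c u) g (e, x) = (-1) ^+ b * g (flips u e, x) :> K.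
Proof.
elim: u e => [|j u IH] e.
  by exists false => g x; rewrite /cword big_nil rep_act1 mul1r.
have [b Hb] := IH (flip j e); exists (sg (inr j) e (+) b) => g x.
by rewrite cword_cons rep_actM rep_act_c rep_cliffE /act1 /fiber /= Hb mulrA -signr_addb.
Qed.

Lemma flipsE u e k : flips u e k = e k (+) odd (count_mem k u).
Proof.
elim: u e => [|j u IH] e /=; first by rewrite addbF.
by rewrite IH flipE oddD oddb addbA eq_sym.
Qed.

Lemma HC_tr_words u s : exists b : bool, HC_tr (cword c u * Tword T s) =
  (-1) ^+ b * ((flips u e0 == e0) && (sort_word s 1%g == w0 n))%:R.
Proof.
have [b Hb] := rep_cword u e0.
exists (odd (ninv (w0 n)) (+) b (+) odd (size s)).
rewrite /HC_tr rep_actM Hb rep_Tword vacuumE !signr_addb !signr_odd -mulnb natrM.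
by rewrite !mulrA; congr (_ * _); rewrite -!mulrA; congr (_ * (_ * _)); rewrite mulrC.
Qed.

Lemma HC_tr_Tword s : HC_tr (Tword T s) =
  (-1) ^+ (ninv (w0 n) + size s) * (sort_word s 1%g == w0 n)%:R.
Proof. by rewrite /HC_tr rep_Tword vacuumE eqxx mul1r exprD mulrA. Qed.

Lemma flips_enum D k : flips (enum D) e0 k = (k \in D).
Proof. by rewrite flipsE ffunE (count_uniq_mem _ (enum_uniq _)) mem_enum oddb. Qed.

Lemma flips_enum_e0 D : (flips (enum D) e0 == e0) = (D == set0).
Proof.
apply/eqP/eqP => [/ffunP H | ->].
  by apply/setP=> k; rewrite -flips_enum H ffunE inE.
by apply/ffunP=> k; rewrite flips_enum inE ffunE.
Qed.

Lemma HC_tr_reduced w : HC_tr (Tword T (reduced_word w)) = (w == w0 n)%:R.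
Proof.
have red := reduced_wordP w.
rewrite HC_tr_Tword (sort_word_reduced red) -{2}(w0V n) (inj_eq invg_inj).
have [Ew|neq] := eqVneq w (w0 n); last by rewrite mulr0.
have [_ ->] := (reducedE _ w).1 red.
by rewrite Ew addnn -muln2 exprM sqrr_sign mulr1.
Qed.

Lemma HC_tr_values : HC_trace_values (HC_tr : {scalar A}).
Proof.
move=> D w s red; rewrite longest_permE.
rewrite -[LHS]/(HC_tr ((\prod_(j in D) c j) * Tword T s)).
rewrite (Tword_matsumoto (@HC_TTcomm K n) (@HC_braid K n) red (reduced_wordP w)).
have [->|nD] := eqVneq D set0; first by rewrite big_set0 !mul1r HC_tr_reduced.
have [b] := HC_tr_words (enum D) (reduced_word w).
by rewrite flips_enum_e0 (negPf nD) mulr0 mul0r cset_cword.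
Qed.

Lemma HC_tr_unique (tr : {scalar A}) : HC_trace_values tr -> tr =1 HC_tr.
Proof.
move=> trP x; have [k ->] := HC_spanned x.
rewrite linear_sum /= -[RHS]/((HC_tr : {scalar A}) _) linear_sum; apply: eq_bigr => -[D w] _.
rewrite !linearZ /=; congr (_ * _).
apply: etrans (trP D w _ (reduced_wordP w)) _.
exact: esym (HC_tr_values D (reduced_wordP w)).
Qed.

(** * Moving [T_i] around the trace *)

Lemma ninv_max w : (ninv w <= ninv (w0 n))%N.
Proof. by rewrite -(inv_w0_sub w) leq_addr. Qed.

Lemma sort_step_w0 i w :
  (sort_step i w == w0 n) = (w == w0 n) || ((simple_refl i * w)%g == w0 n).
Proof.
have desc y : (y == w0 n) -> ~~ (y (adjl i) < y (adjr i))%N.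
  move/eqP->; apply/negP => /inv_simple_refl E.
  by have := ninv_max (simple_refl i * w0 n)%g; rewrite E ltnn.
rewrite /sort_step; case: (boolP (w (adjl i) < w (adjr i))%N) => asc.
  by case: (boolP (w == w0 n)) => // /desc; rewrite asc.
case: (boolP ((simple_refl i * w)%g == w0 n)) => [/desc|]; last by rewrite orbF.
by rewrite simple_refl_mul_asc.
Qed.

(** As [w0] has no ascent, it is reached exactly from itself and from one swap of it. The two swaps
    agree because [w0] conjugates s_i into the reflection of the reversed index. *)
Lemma sort_value_w0 i w : (sort_value (rev_ord i) w == w0 n) = (sort_step i w == w0 n).
Proof.
have E x : (x^-1%g == w0 n) = (x == w0 n) by rewrite -{1}(w0V n) (inj_eq invg_inj).
have conj : (w0 n * simple_refl (rev_ord i) = simple_refl i * w0 n)%g.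
  apply: (mulgI (w0 n)^-1%g); rewrite mulKg -conjgE tpermJ !w0E rev_adjl rev_adjr.
  by rewrite tpermC.
have Ei (r : 'I_n.-1) : ((simple_refl r)^-1 = simple_refl r)%g by apply: tpermV.
rewrite /sort_value E !sort_step_w0 E; congr (_ || _).
rewrite -E invMg invgK Ei -(inj_eq (mulIg (simple_refl (rev_ord i)))) conj.
rewrite -mulgA /simple_refl tperm2 mulg1 -/(simple_refl i).
by rewrite -(inj_eq (mulgI (simple_refl i))) simple_refl_mulK.
Qed.


Definition rep_value i f : V := [ffun p : E * 'S_n => f (p.1, sort_value i p.2)].

Lemma rep_value_linear i : linear (rep_value i).
Proof. by move=> a f g; apply/ffunP=> p; rewrite !ffunE. Qed.
HB.instance Definition _ i :=
  GRing.isLinear.Build K V V *:%R (rep_value i) (rep_value_linear i).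

Lemma rep_act_value (i : 'I_n.-1) (x : A) f :
  rep_act x (rep_value i f) = rep_value i (rep_act x f).
Proof.
apply: (HC_act_commutant (h := rep_value i : {linear V -> V})) => l g.
apply/ffunP=> -[e y]; rewrite /= [RHS]ffunE /= /rep.
case: l => [i'|j]; last by rewrite !rep_cliffE /act1 /fiber ffunE.
rewrite ffunE [in RHS]ffunE !rep_cliffE /act1 /fiber [rep_value i g _]ffunE; congr (_ + _).
by rewrite !ffunE /= sort_step_value.
Qed.

Lemma swap_e0 i : swap_adj i e0 = e0.
Proof. by apply/ffunP=> k; rewrite !ffunE. Qed.

Lemma par_e0 j : par j e0 = false.
Proof. by rewrite /par big1 // => k _; rewrite ffunE. Qed.

(** At the point (e0, 1) the summand c_i c_(i+1) cancels the Clifford part of [T_i], and only the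
    sorting part is left. *)
Lemma HC_tr_twist i (x : A) :
  HC_tr (twist_T T c i * x) = - ((-1) ^+ ninv (w0 n) * rep_act x top_vector (e0, sort_step i 1%g)).
Proof.
rewrite /HC_tr -mulrN; congr (_ * _); set g := rep_act x _.
have -> : rep_act (twist_T T c i * x) (top_vector) =
    rep_act (T i) g + rep_act (c (adjl i)) (rep_act (c (adjr i)) g).
  apply: etrans (congr1 (rep_act^~ _) (twist_mul _ _ _ _)) (etrans (rep_actD _ _ _) _).
  have E1 := rep_actM (T i) x top_vector.
  have E2 := rep_actM (c (adjl i)) (c (adjr i) * x) top_vector.
  have E3 := rep_actM (c (adjr i)) x top_vector.
  exact (congr2 +%R E1 (etrans E2 (congr1 (rep_act (c (adjl i))) E3))).
rewrite ffunE.
rewrite !rep_act_T !rep_act_c /rep ffunE rep_cliff2 rep_cliffE ffunE.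
rewrite /act1 /fiber /= swap_e0 par_e0 par_flip par_e0 !ffunE /= ltnSn.
rewrite eq_sym (negPf (adjl_neq_adjr i)) flipC.
by rewrite /= !mulN1r !mul1r addrK.
Qed.

(** [T_i] sends the top vector to minus its image under value sorting. That operator passes through
    [x] to the evaluation point, and at the identity permutation sorting values and sorting
    positions coincide. *)
Lemma HC_tr_mulT i (x : A) : HC_tr (x * T i) = HC_tr (twist_T T c (rev_ord i) * x).
Proof.
apply: etrans _ (esym (HC_tr_twist (rev_ord i) x)).
rewrite /HC_tr rep_actM rep_act_T rep_vacuum -mulrN; congr (_ * _).
have -> : sort_step (rev_ord i) 1%g = sort_value (rev_ord i) 1%g.
  by rewrite sort_valueE /sort_step invg1 mulg1 mul1g.
have -> : vacuum (fun y => - (sort_step i y == w0 n)%:R) = - rep_value (rev_ord i) top_vector.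
  apply/ffunP=> -[e y]; rewrite vacuumE [RHS]ffunE [in RHS]ffunE vacuumE /=.
  by rewrite sort_value_w0 mulrN.
by rewrite -scaleN1r rep_actvZ rep_act_value scaleN1r ffunE [in LHS]ffunE.
Qed.

(** * Moving [c_j] past a word in the [T_i] *)

Lemma flip_eq_e0 j e : (flip j e == e0) = (e == flip j e0).
Proof. by rewrite -(inj_eq (inv_inj (flipK j))) flipK. Qed.

Lemma rep_c_top j e x :
  rep (inr j) top_vector (e, x) = (e == flip j e0)%:R * (x == w0 n)%:R :> K.
Proof.
rewrite rep_cliffE /act1 /fiber vacuumE /= flip_eq_e0.
have [->|_] := eqVneq e (flip j e0); last by rewrite !mul0r mulr0.
by rewrite par_flip par_e0 ltnn flipE eqxx ffunE /= mul1r.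
Qed.

Lemma sort_word_short s x : (ninv x + size s < ninv (w0 n))%N -> (sort_word s x == w0 n) = false.
Proof.
by move=> lt; apply/eqP => E; have := sort_word_inv s x; rewrite E leqNgt lt.
Qed.

Lemma swap_flip i k : swap_adj i (flip k e0) = flip (simple_refl i k) e0.
Proof.
apply/ffunP=> m; rewrite !ffunE; congr addb.
by rewrite -(inj_eq (@perm_inj _ (simple_refl i))) simple_reflK.
Qed.

Lemma swap_adjK i : involutive (swap_adj i).
Proof. by move=> e; apply/ffunP=> k; rewrite !ffunE simple_reflK. Qed.

(* Within the length bound every letter [T_i] must act by an actual inversion on the
   permutation, so the lower-order terms vanish and the odd generator is moved along. *)
Lemma rep_Tword_c j s e x : (ninv x + size s <= ninv (w0 n))%N ->
  rep_act (Tword T s) (rep (inr j) top_vector) (e, x) =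
  (-1) ^+ size s * ((e == flip (x^-1%g (rev_ord j)) e0) && (sort_word s x == w0 n))%:R :> K.
Proof.
elim: s e x => [|i s IH] e x /= le.
  rewrite /Tword big_nil rep_act1 rep_c_top mul1r -natrM mulnb.
  case: (eqVneq x (w0 n)) => [->|_]; rewrite ?andbF ?andbT //.
  by rewrite w0V w0E rev_ordK.
have le1 := sort_step_inv i x.
rewrite Tword_cons rep_actM rep_act_T /rep ffunE rep_cliffE ffunE /= /act1 /fiber.
rewrite !IH; [|by move: le le1; lia|by move: le; lia].
have short y : (ninv y <= ninv x)%N -> (sort_word s y == w0 n) = false.
  by move=> le'; apply: sort_word_short; move: le le'; lia.
rewrite (short x) // andbF mulr0 mulr0 addr0.
case: (boolP (x (adjl i) < x (adjr i))%N) => asc; last first.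
  have Es : sort_step i x = x by rewrite /sort_step (negPf asc).
  by rewrite Es short // !andbF !mulr0.
have Es : sort_step i x = (simple_refl i * x)%g by rewrite /sort_step asc.
have -> : (sort_step i x)^-1%g (rev_ord j) = simple_refl i (x^-1%g (rev_ord j)).
  by rewrite Es invMg permM /simple_refl tpermV.
rewrite -swap_flip (inj_eq (inv_inj (swap_adjK i))) exprS -mulrA.
have [->|_] := eqVneq e _; last by rewrite !mulr0.
(* Only one bit of [e] is set, so the bits i and i+1 are not both set and [rep_sort] contributes
   -1. *)
congr (_ * _); rewrite !flipE !ffunE /=.
case: eqP => [<-|_] //; rewrite (_ : _ == _ = false) //; apply/negbTE.
by rewrite eq_sym adjl_neq_adjr.
Qed.

End Trace.

(** * Frobenius property and Nakayama automorphism *)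

Section Eigen.
Variables (K : fieldType) (A : algType K) (theta : {lrmorphism A -> A}).
Implicit Types (a b : K) (x y : A).

Lemma eigen_lin a b x y :
  theta x = b *: x -> theta y = b *: y -> theta (a *: x + y) = b *: (a *: x + y).
Proof. by move=> Ex Ey; rewrite linearP /= Ex Ey scalerDr !scalerA mulrC. Qed.

Lemma eigen_mul a b x y :
  theta x = a *: x -> theta y = b *: y -> theta (x * y) = (a * b) *: (x * y).
Proof. by move=> Ex Ey; rewrite rmorphM /= Ex Ey -scalerAl -scalerAr scalerA. Qed.

Hypothesis two_neq0 : 2%:R != 0 :> K.

Lemma eqN_eq0 x : x = - x -> x = 0.
Proof.
move/eqP; rewrite -addr_eq0 -mulr2n -scaler_nat scaler_eq0.
by rewrite (negPf two_neq0) => /eqP.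
Qed.

Lemma eigen_split (b : bool) x y : theta x = x -> theta y = - y ->
  theta (x + y) = (-1) ^+ b *: (x + y) -> x + y = if b then y else x.
Proof.
move=> Ex Ey; rewrite linearD /= Ex Ey; case: b; rewrite ?scale1r ?scaleN1r => E.
  suff -> : x = 0 by rewrite add0r.
  by apply: eqN_eq0; apply: (addIr (- y)); rewrite E opprD.
suff -> : y = 0 by rewrite addr0.
by apply: eqN_eq0; apply: (addrI x); rewrite E.
Qed.

End Eigen.

Lemma scalar_fun0 (K : fieldType) (A : lmodType K) (f : A -> K) : scalar f -> f 0 = 0.
Proof. by move=> flin; have := flin (-1) 0 0; rewrite scaler0 addr0 mulN1r addNr. Qed.

Lemma scalar_proportional (K : fieldType) (A : lmodType K) (f g : A -> K) s :
  scalar f -> scalar g -> f 0 = s * g 0 /\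
  (forall a y z, f y = s * g y -> f z = s * g z -> f (a *: y + z) = s * g (a *: y + z)).
Proof.
move=> flin glin; split; first by rewrite !scalar_fun0 // mulr0.
by move=> a y z Ey Ez; rewrite flin glin Ey Ez mulrDr mulrCA.
Qed.

Section Frobenius.
Variables (K : fieldType) (n : nat).
Local Notation A := (HC K n).
Local Notation T := (@HC_T K n).
Local Notation c := (@HC_c K n).
Local Notation tr := (@HC_tr K n).
Local Notation basis := (HC_basis T c).
Local Notation w0 := (w0 n).
Implicit Types (i : 'I_n.-1) (j k : 'I_n) (w : 'S_n) (D : {set 'I_n}) (x y z : A).

Lemma HC_span_eq (f g : A -> K) :
  scalar f -> scalar g -> (forall p, f (basis p) = g (basis p)) -> f =1 g.
Proof.
move=> flin glin fgb x; have [k ->] := HC_spanned x.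
elim: (index_enum _) => [|p r IH]; last by rewrite big_cons flin glin fgb IH.
by rewrite big_nil !scalar_fun0.
Qed.

(** A factor [T_i] on the right returns on the left as a twisted generator, where it is absorbed by
    the arbitrary multiplier. *)
Lemma HC_left_nondegenerate_Tword x s : (forall a, tr (a * x) = 0) ->
  forall a, tr (a * (x * Tword T s)) = 0.
Proof.
elim: s x => [|i s IH] x tr0 a; first by rewrite /Tword big_nil mulr1.
rewrite Tword_cons [x * _]mulrA; apply: IH => b.
by rewrite [b * _]mulrA HC_tr_mulT mulrA tr0.
Qed.

Lemma flips_cat (u v : seq 'I_n) e : flips (u ++ v) e = flips v (flips u e).
Proof. by rewrite /flips foldl_cat. Qed.

Lemma flips_enum2 D D' : (flips (enum D ++ enum D') (e0 n) == e0 n) = (D == D').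
Proof.
have E k : flips (enum D ++ enum D') (e0 n) k = (k \in D) (+) (k \in D').
  by rewrite flips_cat flipsE flips_enum (count_uniq_mem _ (enum_uniq _)) mem_enum oddb.
apply/eqP/eqP => [H | ED].
  apply/setP=> k; have := E k; rewrite H ffunE.
  by case: (k \in D); case: (k \in D').
by apply/ffunP=> k; rewrite E ED addbb ffunE.
Qed.

(* Pairing with [c_D T_(w^-1 w0)] isolates the coefficient of [c_D T_w] among the
   basis elements that are not longer. *)
Lemma HC_tr_pairing D D' w w' : (ninv w' <= ninv w)%N ->
  exists b : bool,
    tr ((\prod_(j in D) c j) * (basis (D', w') * Tword T (reduced_word (w^-1 * w0)%g)))
    = (-1) ^+ b * ((D == D') && (w == w'))%:R.
Proof.
move=> le; set t := reduced_word _.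
have [b Hb] := HC_tr_words K (enum D ++ enum D') (reduced_word w' ++ t).
exists b; rewrite cset_cword.
apply: etrans (congr1 tr (cword_basis_Tword _ _ _ _ _ _)) _.
rewrite {}Hb flips_enum2; congr (_ * (_ && _)%:R).
have [Ew' sw'] := (reducedE _ _).1 (reduced_wordP w').
have [Et st] := (reducedE _ _).1 (reduced_wordP (w^-1 * w0)%g).
have El : (ninv w + ninv (w^-1 * w0)%g = ninv w0)%N by rewrite -{1}(invV w) inv_w0_sub.
apply/eqP/eqP => [E | <-].
  (* The word has at most [ninv w0] letters, so reaching [w0] requires a swap at each of them; its
     product is then determined, which gives w' = w. *)
  have := sort_word_inv (reduced_word w' ++ t) 1%g.
  rewrite E inv1 add0n size_cat sw' st => le1.
  have := @sort_word_full _ (reduced_word w' ++ t) 1%g.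
  rewrite E inv1 add0n size_cat sw' st => E1.
  have {E1} : w0 = ((w' * (w^-1 * w0))^-1)%g.
    rewrite {1}E1 ?mulg1 ?word_perm_rev ?word_perm_cat ?Ew' ?Et //.
    by apply/eqP; rewrite eqn_leq le1; lia.
  move/(congr1 (fun v : {perm _} => v^-1)%g); rewrite invgK w0V mulgA => /esym/(canRL (mulgK _)).
  by rewrite mulgV => /(canRL (mulgK _)); rewrite mul1g invgK.
have red : reduced_expression (reduced_word w ++ t) w0.
  have [Ew sw] := (reducedE _ _).1 (reduced_wordP w).
  by rewrite reducedE word_perm_cat Ew Et mulKVg size_cat sw st.
by rewrite (sort_word_reduced red) w0V.
Qed.

Lemma HC_nondegenerate x : (forall a, tr (a * x) = 0) -> x = 0.
Proof.
move=> tr0; have [k Ek] := HC_spanned x.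
have [/forallP k0|] := boolP [forall p, k p == 0].
  by rewrite Ek big1 // => p _; rewrite (eqP (k0 p)) scale0r.
case/forallPn => p0 kp0.
case: (@arg_maxnP _ p0 (fun p => k p != 0) (fun p => ninv p.2) kp0) => -[D w] knz maxw.
have := HC_left_nondegenerate_Tword (reduced_word (w^-1 * w0)%g) tr0 (\prod_(j in D) c j).
rewrite Ek mulr_suml mulr_sumr -[tr _]/((tr : {scalar A}) _) linear_sum.
rewrite (bigD1 (D, w)) //= [X in _ + X]big1 => [|[D' w'] neq].
  rewrite addr0 -scalerAl -scalerAr linearZ /=.
  have [b ->] := HC_tr_pairing D D (leqnn (ninv w)).
  by rewrite !eqxx mulr1 => /eqP; rewrite mulf_eq0 signr_eq0 orbF (negPf knz).
have [k0|knz'] := eqVneq (k (D', w')) 0.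
  by rewrite k0 scale0r mul0r mulr0 linear0.
rewrite -scalerAl -scalerAr linearZ /=.
have [b ->] := HC_tr_pairing D D' (maxw (D', w') knz').
move: neq; rewrite xpair_eqE eq_sym [w' == w]eq_sym => /negPf ->.
by rewrite mulr0 mulr0.
Qed.

Lemma HC_finite_dimensional : finite_dimensional A.
Proof.
pose I := ({set 'I_n} * 'S_n)%type.
exists #|{: I}|, (fun q : 'I_#|{: I}| => basis (enum_val q)) => x.
have [k ->] := HC_spanned x; exists (fun q => k (enum_val q)).
by rewrite -(big_enum_val (A := {: I}) (fun p => k p *: basis p)).
Qed.

(** * The grading *)

Section Parity.
Variable theta : {lrmorphism A -> A}.
Hypothesis thetaT : forall i, theta (T i) = T i.
Hypothesis thetac : forall j, theta (c j) = - c j.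

Definition let_odd (l : HC_letter n) : bool := if l is inr _ then true else false.

Lemma word_parity_cons l u : word_parity (l :: u) = let_odd l (+) word_parity u.
Proof. by rewrite /word_parity /= oddD oddb. Qed.

Lemma theta_word (u : seq (HC_letter n)) :
  theta (HC_word K u) = (-1) ^+ word_parity u *: HC_word K u.
Proof.
have H := @rmorph_sign_prod _ _ theta _ (@HC_let K n) let_odd u; apply: H => -[i|j] /=.
  by rewrite scale1r; apply: thetaT.
by rewrite scaleN1r; apply: thetac.
Qed.

Lemma HC_parity0 b : HC_parity b (0 : A).
Proof.
exists 0; last by rewrite raddf0.
by move=> u; rewrite msupp0 inE.
Qed.

Lemma HC_parity_lin b a x y : HC_parity b x -> HC_parity b y -> HC_parity b (a *: x + y).
Proof.
move=> [p Pp ->] [q Pq ->]; exists (a *: p + q).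
  move=> u /(fsubsetP (msuppD_le _ _)); rewrite inE => /orP[|/Pq //].
  by move/(fsubsetP (msuppZ_le _ _))/Pp.
have E1 := HC_piD (a *: p) q; have E2 := HC_pi_scale a p.
exact (etrans (congr1 (fun z => z + _) E2) (esym E1)).
Qed.

Lemma HC_parity_word (u : seq (HC_letter n)) : HC_parity (word_parity u) (HC_word K u).
Proof.
exists << FMonom u >>; last by rewrite HC_pi_word.
by move=> v; rewrite msuppU1 inE => /eqP ->.
Qed.

Lemma HC_parity_ind b (P : A -> Prop) :
  P 0 -> (forall a x y, P x -> P y -> P (a *: x + y)) ->
  (forall u, word_parity u = b -> P (HC_word K u)) -> forall x, HC_parity b x -> P x.
Proof.
move=> P0 PD Pw x [p Pp ->]; rewrite HC_pi_sum big_seq.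
apply: (big_ind P) => // [y z Py Pz|u /Pp Eu].
  by have := PD 1 y z Py Pz; rewrite scale1r.
by have := PD p@_u _ _ (Pw u Eu) P0; rewrite addr0.
Qed.

Lemma HC_decompose x : exists x0 x1, [/\ HC_parity false x0, HC_parity true x1 & x = x0 + x1].
Proof.
elim/HC_word_ind: x => [|a x y [x0 [x1 [P0 P1 ->]]] [y0 [y1 [Q0 Q1 ->]]]|u].
- by exists 0, 0; rewrite addr0; split=> //; apply: HC_parity0.
- exists (a *: x0 + y0), (a *: x1 + y1); split; [exact: HC_parity_lin|exact: HC_parity_lin|].
  by rewrite scalerDr addrACA.
have := HC_parity_word u; case: (word_parity u) => Pu.
  by exists 0, (HC_word K u); rewrite add0r; split=> //; apply: HC_parity0.
by exists (HC_word K u), 0; rewrite addr0; split=> //; apply: HC_parity0.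
Qed.

Lemma theta_parity b x : HC_parity b x -> theta x = (-1) ^+ b *: x.
Proof.
apply: (HC_parity_ind (P := fun x => theta x = (-1) ^+ b *: x)) => [|a y z Ey Ez|u <-].
- by rewrite linear0 scaler0.
- exact: eigen_lin Ey Ez.
exact: theta_word.
Qed.

Hypothesis two_neq0 : 2%:R != 0 :> K.

(** Replaces the existence of a homogeneous representative by an eigenvalue equation. That
    homogeneous components multiply correctly and meet only in 0 is deduced from this form. *)
Lemma HC_parityP b x : HC_parity b x <-> theta x = (-1) ^+ b *: x.
Proof.
split; first exact: theta_parity.
have [x0 [x1 [P0 P1 ->]]] := HC_decompose x.
have E0 := theta_parity P0; have E1 := theta_parity P1.
rewrite scale1r in E0; rewrite scaleN1r in E1.
by move/(eigen_split two_neq0 E0 E1) ->; case: b.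
Qed.

Lemma theta_cword_Tword u s :
  theta (cword c u * Tword T s) = (-1) ^+ size u *: (cword c u * Tword T s).
Proof.
have Ec : theta (cword c u) = (-1) ^+ size u *: cword c u.
  have := @rmorph_sign_prod _ _ theta _ c xpredT u.
  by rewrite count_predT signr_odd; apply=> j; rewrite scaleN1r; apply: thetac.
have ET : theta (Tword T s) = Tword T s.
  have := @rmorph_sign_prod _ _ theta _ T xpred0 s.
  by rewrite count_pred0 scale1r; apply=> i; rewrite scale1r; apply: thetaT.
apply: etrans (rmorphM theta _ _) (etrans (congr2 *%R Ec ET) _).
exact: esym (scalerAl _ (cword c u) (Tword T s)).
Qed.

Lemma flips_enum1 D j : (flips (enum D) (e0 n) == Nontrivial.flip j (e0 n)) = (D == [set j]).
Proof.
apply/eqP/eqP => [E | ->].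
  by apply/setP=> k; rewrite -flips_enum E Nontrivial.flipE ffunE inE.
by apply/ffunP=> k; rewrite flips_enum Nontrivial.flipE ffunE inE.
Qed.

Lemma flips_cons1 D j : (flips (j :: enum D) (e0 n) == e0 n) = (D == [set j]).
Proof.
have E k : flips (j :: enum D) (e0 n) k = (k == j) (+) (k \in D).
  rewrite flipsE ffunE /= (count_uniq_mem _ (enum_uniq _)) mem_enum oddD !oddb.
  by rewrite eq_sym.
apply/eqP/eqP => [H | ED].
  apply/setP=> k; have := E k; rewrite H ffunE inE.
  by case: (k == j); case: (k \in D).
by apply/ffunP=> k; rewrite E ED inE addbb ffunE.
Qed.

(** Writing the super sign as [theta x] makes both sides linear in [x], so c_D T_w can be tested. A
    reduced word started at the identity meets the length bound of [rep_Tword_c], and both sides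
    vanish unless D is the singleton of [rev_ord j]. *)
Lemma HC_tr_mulc j x : tr (x * c j) = tr (- c (rev_ord j) * theta x).
Proof.
move: x; apply: (HC_span_eq
  (f := fun x => tr (x * c j)) (g := fun x => tr (- c (rev_ord j) * theta x))).
- by move=> a x y; rewrite mulrDl -scalerAl linearP.
- by move=> a x y; rewrite linearP mulrDr -scalerAr linearP.
case=> D w; rewrite /HC_basis /= cset_cword theta_cword_Tword.
set s := reduced_word w; have [_ sw] := (reducedE _ _).1 (reduced_wordP w).
have le : (ninv (1%g : 'S_n) + size s <= ninv w0)%N by rewrite inv1 sw ninv_max.
set r := rev_ord j.
have L : tr (cword c (enum D) * Tword T s * c j) = (-1) ^+ ninv w0 *
    rep_act (cword c (enum D)) (rep_act (Tword T s) (rep (inr j) (top_vector K n))) (e0 n, 1%g).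
  by rewrite /HC_tr !rep_actM rep_act_c.
have val e : rep_act (Tword T s) (rep (inr j) (top_vector K n)) (e, 1%g) =
    (-1) ^+ size s * ((e == Nontrivial.flip r (e0 n)) && (sort_word s 1%g == w0))%:R :> K.
  by rewrite rep_Tword_c // invg1 perm1.
have R : tr (- c r * ((-1) ^+ size (enum D) *: (cword c (enum D) * Tword T s))) =
    - (-1) ^+ size (enum D) * tr (cword c (r :: enum D) * Tword T s).
  apply: etrans (congr1 tr (neg_c_cword _ _ _ _ _)) _; exact: linearZ.
apply: etrans L (etrans _ (esym R)); have [ED|nD] := eqVneq D [set r]; last first.
  have [b Hb] := rep_cword K (enum D) (e0 n); rewrite {}Hb {}val flips_enum1 (negPf nD).
  have [b' ->] := HC_tr_words K (r :: enum D) s.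
  by rewrite flips_cons1 (negPf nD) !mulr0.
have -> : enum D = [:: r] by rewrite ED enum_set1.
have -> : tr (cword c [:: r; r] * Tword T s) = - tr (Tword T s).
  apply: etrans (congr1 tr (cword_double (@HC_cc K n) _ _)) (etrans (linearZ _ _) _).
  exact: mulN1r.
have -> : cword c [:: r] = c r by rewrite /cword big_seq1.
rewrite rep_act_c rep_cliffE /Nontrivial.act1 /fiber /= val eqxx HC_tr_Tword par_e0 ffunE /=.
by rewrite exprD; ring.
Qed.

Lemma HC_parity_mul b b' x y :
  HC_parity b x -> HC_parity b' y -> HC_parity (b (+) b') (x * y).
Proof.
move=> /HC_parityP Px /HC_parityP Py; have E := eigen_mul Px Py.
by rewrite -signr_addb in E; apply/HC_parityP.
Qed.

Lemma HC_superalgebra : is_superalgebra (@HC_parity K n).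
Proof.
split=> [b||x /HC_parityP E0 /HC_parityP E1||].
- by split; [exact: HC_parity0|exact: HC_parity_lin].
- exact: HC_decompose.
- apply: (eqN_eq0 two_neq0); rewrite scale1r in E0; rewrite scaleN1r in E1.
  by rewrite -E1 E0.
- by have := @HC_parity_word [::]; rewrite /HC_word big_nil.
exact: HC_parity_mul.
Qed.

Lemma HC_tr_theta x : tr (theta x) = tr x.
Proof.
move: x; apply: HC_span_eq.
- by move=> a x y; rewrite !linearP.
- exact: HC_tr_scalar.
case=> D w; rewrite /HC_basis /= cset_cword theta_cword_Tword linearZ /=.
have [b ->] := HC_tr_words K (enum D) (reduced_word w); rewrite flips_enum_e0.
by have [->|nD] := eqVneq D set0; rewrite ?enum_set0 ?mul1r // !mulr0.
Qed.

Lemma HC_tr_odd x : HC_parity true x -> tr x = 0.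
Proof.
move/HC_parityP => E; have := HC_tr_theta x; rewrite E linearZ /= mulN1r => Ex.
apply: (@eqN_eq0 K K^o two_neq0); exact: esym Ex.
Qed.

Lemma HC_frobenius : is_frobenius_superalgebra (@HC_parity K n) (tr : {scalar A}).
Proof.
split; [exact: HC_superalgebra|exact: HC_finite_dimensional|exact: HC_tr_odd|].
by move=> I [_ _ Imul] I0 x Ix; apply: HC_nondegenerate => a; apply/I0/Imul.
Qed.

(** * The Nakayama identity and uniqueness of the automorphism *)

Section Nakayama.
Variable phi : {lrmorphism A -> A}.
Hypothesis phiT : forall i, phi (T i) = twist_T T c (rev_ord i).
Hypothesis phic : forall j, phi (c j) = - c (rev_ord j).

Lemma HC_tr_let (l : HC_letter n) b x : HC_parity b x ->
  tr (x * HC_let K l) = (-1) ^+ (b && let_odd l) * tr (phi (HC_let K l) * x).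
Proof.
case: l => [i|j] /= Px.
  by rewrite andbF mul1r phiT; apply: HC_tr_mulT.
rewrite andbT phic; apply: etrans (HC_tr_mulc j x) _.
rewrite (theta_parity Px).
exact: etrans (congr1 tr (esym (scalerAr _ (- c (rev_ord j)) x))) (linearZ _ _).
Qed.

Lemma phi_let_parity (l : HC_letter n) : HC_parity (let_odd l) (phi (HC_let K l)).
Proof.
apply/HC_parityP; case: l => [i|j] /=.
  by rewrite phiT scale1r; apply: theta_twist.
by rewrite phic rmorphN /= thetac scaleN1r.
Qed.

Lemma HC_word_cons (l : HC_letter n) u : HC_word K (l :: u) = HC_let K l * HC_word K u.
Proof. exact: big_cons. Qed.

Lemma phi_word_parity (u : seq (HC_letter n)) : HC_parity (word_parity u) (phi (HC_word K u)).
Proof.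
elim: u => [|l u IH].
  by rewrite /HC_word big_nil rmorph1; case: HC_superalgebra.
rewrite HC_word_cons rmorphM word_parity_cons.
exact: HC_parity_mul (phi_let_parity l) IH.
Qed.

Lemma phi_parity b x : HC_parity b x -> HC_parity b (phi x).
Proof.
apply: (HC_parity_ind (P := fun x => HC_parity b (phi x))) => [|a y z Py Pz|u <-];
  last exact: phi_word_parity.
- by rewrite linear0; exact: HC_parity0.
by rewrite linearP; apply: HC_parity_lin.
Qed.

(** The tail [u] is carried around the trace first and the letter [l] second, which yields phi(l)
    phi(u) in the right order. *)
Lemma HC_tr_word (u : seq (HC_letter n)) b x : HC_parity b x ->
  tr (x * HC_word K u) = (-1) ^+ (b && word_parity u) * tr (phi (HC_word K u) * x).
Proof.
elim: u b x => [|l u IH] b x Px.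
  by rewrite /HC_word big_nil rmorph1 andbF !mul1r mulr1.
have Pl : HC_parity (let_odd l) (HC_let K l).
  have := HC_parity_word [:: l]; rewrite /HC_word big_seq1.
  by rewrite word_parity_cons addbF.
rewrite !HC_word_cons rmorphM word_parity_cons.
apply: etrans (congr1 tr (mulrA _ _ _)) (etrans (IH _ _ (HC_parity_mul Px Pl)) _).
have Pw := HC_parity_mul (phi_word_parity u) Px.
have E := etrans (congr1 tr (mulrA (phi (HC_word K u)) x (HC_let K l))) (HC_tr_let l Pw).
apply: etrans (congr1 ( *%R _) E) _.
have Et := congr1 tr (mulrA (phi (HC_let K l)) (phi (HC_word K u)) x).
apply: etrans _ (congr1 ( *%R _) Et); move: (tr (_ * (_ * x))) => t.
rewrite mulrA -signr_addb; congr (_ ^+ _ * _).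
(* The sign between [l] and [u] occurs twice and cancels. *)
by case: b {Px IH Pw E}; case: (let_odd l); case: (word_parity u).
Qed.

Lemma HC_tr_nakayama b b' x y : HC_parity b x -> HC_parity b' y ->
  tr (x * y) = (-1) ^+ (b * b') * tr (phi y * x).
Proof.
move=> Px; rewrite mulnb; move: y.
have s1 : scalar (fun y => tr (x * y)).
  by move=> a y z; rewrite mulrDr -scalerAr linearP.
have s2 : scalar (fun y => tr (phi y * x)).
  by move=> a y z; rewrite linearP mulrDl -scalerAl linearP.
have [p0 plin] := scalar_proportional ((-1) ^+ (b && b')) s1 s2.
apply: (HC_parity_ind (P := fun y => tr (x * y) = (-1) ^+ (b && b') * tr (phi y * x)))
  => [|a y z Ey Ez|u <-]; last exact: HC_tr_word.
- exact: p0.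
exact (plin a y z Ey Ez).
Qed.

Lemma phi_involutive : involutive phi.
Proof.
have H := @HC_ind K n (fun x => phi (phi x) = x); apply: H => [|a x y Ex Ey|i x Ex|j x Ex].
- by rewrite !rmorph1.
- by rewrite !linearP /= Ex Ey.
- by rewrite !rmorphM /= Ex (twist_involutive (@HC_ccanti K n) phiT phic).
by rewrite !rmorphM /= Ex phic rmorphN /= phic rev_ordK opprK.
Qed.

Lemma phi_nakayama : is_nakayama_automorphism (@HC_parity K n) (tr : {scalar A}) phi.
Proof.
split; [exact: inv_bij phi_involutive|exact: phi_parity|exact: HC_tr_nakayama].
Qed.

(** Since [phi] is an involution, the Nakayama identity rewrites tr(x phi(z)) as a signed tr(z x),
    so [HC_nondegenerate] applies to [phi z]. *)
Lemma HC_right_nondegenerate b z : HC_parity b z ->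
  (forall b' x, HC_parity b' x -> tr (z * x) = 0) -> z = 0.
Proof.
move=> Pz z0; rewrite -(phi_involutive z).
suff -> : phi z = 0 by rewrite linear0.
have h b' x : HC_parity b' x -> tr (x * phi z) = 0.
  move=> Px; rewrite (HC_tr_nakayama Px (phi_parity Pz)) phi_involutive.
  by rewrite (z0 _ _ Px) mulr0.
apply: HC_nondegenerate => a; have [a0 [a1 [P0 P1 ->]]] := HC_decompose a.
apply: etrans (congr1 tr (mulrDl _ _ _)) (etrans (linearD _ _ _) _).
exact (etrans (congr2 +%R (h _ _ P0) (h _ _ P1)) (addr0 0)).
Qed.

(** For homogeneous y, both automorphisms express tr(x y) with the same sign, so psi(y) - phi(y)
    pairs to zero with every homogeneous x. *)
Lemma HC_nakayama_unique (psi : {lrmorphism A -> A}) :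
  is_nakayama_automorphism (@HC_parity K n) (tr : {scalar A}) psi -> psi =1 phi.
Proof.
case=> _ psi_par psi_tr.
have h b y : HC_parity b y -> psi y = phi y.
  move=> Py; apply/eqP; rewrite -subr_eq0; apply/eqP.
  have Pz : HC_parity b (psi y - phi y).
    rewrite addrC -scaleN1r; apply: HC_parity_lin; [exact: phi_parity|exact: psi_par].
  apply: (HC_right_nondegenerate Pz) => b' x Px.
  have E := etrans (esym (psi_tr _ _ _ _ Px Py)) (HC_tr_nakayama Px Py).
  have s : (-1) ^+ (b' * b) != 0 :> K by rewrite signr_eq0.
  apply: etrans (congr1 tr (mulrBl _ _ _)) (etrans (linearB _ _ _) _).
  exact (etrans (congr1 (fun t => t - tr (phi y * x)) (mulfI s E)) (subrr _)).
move=> x; have [x0 [x1 [P0 P1 ->]]] := HC_decompose x.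
by rewrite !linearD /= (h _ _ P0) (h _ _ P1).
Qed.

End Nakayama.

End Parity.

End Frobenius.

Theorem proposition3p3p6 (K : closedFieldType) (n : nat) :
  [pchar K] =i pred0 -> (1 <= n)%N ->
  exists tr : {scalar HC K n},
    [/\ HC_trace_values tr,
        forall tr' : {scalar HC K n}, HC_trace_values tr' -> tr' =1 tr,
        is_frobenius_superalgebra (@HC_parity K n) tr
      & exists phi : {lrmorphism HC K n -> HC K n},
          [/\ is_nakayama_automorphism (@HC_parity K n) tr phi
              /\ (forall psi : {lrmorphism HC K n -> HC K n},
                    is_nakayama_automorphism (@HC_parity K n) tr psi -> psi =1 phi),
              involutive phi,
              forall i : 'I_n.-1,
                phi (HC_T K i) =
                HC_T K (rev_ord i)
                + HC_c K (adjl (rev_ord i)) * HC_c K (adjr (rev_ord i))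
            & forall j : 'I_n, phi (HC_c K j) = - HC_c K (rev_ord j)]].
Proof.
move=> char0 _; have two_neq0 : 2%:R != 0 :> K.
  by rewrite (pcharf0P K).1.
have [theta [thetaT thetac]] := HC_parity_automorphism K n.
have [phi [phiT phic]] := HC_nakayama_automorphism K n.
exists (HC_tr (K := K) (n := n)); split.
- exact: HC_tr_values.
- exact: HC_tr_unique.
- exact: HC_frobenius thetaT thetac two_neq0.
exists phi; split=> //.
- split; first exact: (phi_nakayama thetaT thetac two_neq0 phiT phic).
  exact: (HC_nakayama_unique thetaT thetac two_neq0 phiT phic).
exact: phi_involutive phiT phic.
Qed.
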